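(* Suppose each $f_i$ is convex and differentiable with $(1/\gamma_i)$-Lipschitz continuous gradient and $g$ is $\lambda$-strongly convex, and let $(w^\star,\alpha^\star)$ be the saddle point of $L(w,\alpha)$. Let $\delta>0$ and let $\Gamma_\delta$ be a constant that satisfies $$\Gamma_\delta \ge \max_{i,k}\left\{ \frac{1}{p_i}\left(1 + \frac{9\|X_{ik}\|^2}{2 q_k \lambda\gamma_i(1+\delta)^2}\right),\ \frac{1}{q_k}\left(1 + \frac{9n\|X_{ik}\|^2}{2 p_i m\lambda\gamma_i(1+\delta)^2}\right),\ \frac{1}{p_i q_k}\right\}.$$ With either option (option 1 or option 2) in the Accelerated DSCOVR algorithm (described in the context), if we choose the step sizes used inside DSCOVR-SVRG or DSCOVR-SAGA as $$\sigma_i=\frac{1}{2(1+\delta)\gamma_i(p_i\Gamma_\delta-1)},\quad i=1,\ldots,m,\qquad \tau_k=\frac{1}{2(1+\delta)\lambda(q_k\Gamma_\delta-1)},\quad k=1,\ldots,n,$$ then for all $r\ge1$, $$\mathbf{E}\left[\Omega\bigl(\tilde w^{(r)}-w^\star,\tilde\alpha^{(r)}-\alpha^\star\bigr)\right]\le\left(1-\frac{1}{2(1+\delta)}\right)^{2r}\Omega\bigl(\tilde w^{(0)}-w^\star,\tilde\alpha^{(0)}-\alpha^\star\bigr).$$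
   Context: Setting. $m,n,N_1,\ldots,N_m,d_1,\ldots,d_n$ are positive integers, $N=\sum_i N_i$, $d=\sum_k d_k$. Vectors $w\in\mathbb{R}^d$ are partitioned as $w=[w_1;\ldots;w_n]$ with $w_k\in\mathbb{R}^{d_k}$, and $\alpha\in\mathbb{R}^N$ as $\alpha=[\alpha_1;\ldots;\alpha_m]$ with $\alpha_i\in\mathbb{R}^{N_i}$. The matrix $X\in\mathbb{R}^{N\times d}$ is partitioned conformally into blocks $X_{ik}\in\mathbb{R}^{N_i\times d_k}$; $X_{i:}\in\mathbb{R}^{N_i\times d}$ denotes the $i$-th block row. Given are functions $f_i:\mathbb{R}^{N_i}\to\mathbb{R}$ and $g(w)=\sum_{k=1}^n g_k(w_k)$ with $g_k:\mathbb{R}^{d_k}\to\mathbb{R}$, and constants $\lambda>0$, $\gamma_i>0$. $f_i^*(\alpha_i)=\sup_{u}\{\alpha_i^Tu-f_i(u)\}$ is the convex conjugate, and $$L(w,\alpha)=\frac1m\sum_{i=1}^m\alpha_i^TX_{i:}w-\frac1m\sum_{i=1}^m f_i^*(\alpha_i)+g(w).$$ $\lambda$-strong convexity of $g$ means $g(w')\ge g(w)+\xi^T(w'-w)+\frac\lambda2\|w'-w\|^2$ for all $w,w'$ and $\xi\in\partial g(w)$. A saddle point satisfies $L(w^\star,\alpha)\le L(w^\star,\alpha^\star)\le L(w,\alpha^\star)$ for all $(w,\alpha)$; under the stated assumptions on $f_i,g$ it exists and is unique. Norms: $\|\cdot\|$ is the Euclidean norm for vectors and the spectral norm for matrices. Define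 $\Omega(w,\alpha)=\lambda\|w\|^2+\frac1m\sum_{i=1}^m\gamma_i\|\alpha_i\|^2$. The proximal mapping is $\mathbf{prox}_\phi(v)=\arg\min_u\{\phi(u)+\frac12\|u-v\|^2\}$. $p=(p_1,\ldots,p_m)$ and $q=(q_1,\ldots,q_n)$ are probability distributions with all $p_i,q_k>0$; the step sizes are understood to be positive finite numbers (i.e. $p_i\Gamma_\delta>1$, $q_k\Gamma_\delta>1$). Accelerated DSCOVR algorithm. Input: deterministic $\tilde w^{(0)}\in\mathbb{R}^d$, $\tilde\alpha^{(0)}\in\mathbb{R}^N$. For round $r=0,1,2,\ldots$, consider the perturbed saddle-point function $$L_\delta^{(r)}(w,\alpha)=L(w,\alpha)+\frac{\delta\lambda}2\|w-\tilde w^{(r)}\|^2-\frac{\delta}{2m}\sum_{i=1}^m\gamma_i\|\alpha_i-\tilde\alpha_i^{(r)}\|^2,$$ and find an approximate saddle point of it by one of: Option 1: $(\tilde w^{(r+1)},\tilde\alpha^{(r+1)})=\text{DSCOVR-SVRG}(\tilde w^{(r)},\tilde\alpha^{(r)},S,M)$ with $S=\frac{2\log(2(1+\delta))}{\log(3/2)}$, $M=\log(3)\Gamma_\delta$. Option 2: $(\tilde w^{(r+1)},\tilde\alpha^{(r+1)})=\text{DSCOVR-SAGA}(\tilde w^{(r)},\tilde\alpha^{(r)},M)$ with $M=6\log\bigl(\frac{8(1+\delta)}3\bigr)\Gamma_\delta$. ($S$ and $M$ are rounded up to integers.) Both routines are applied to $L_\delta^{(r)}$, i.e. with $g_k$ replaced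 by $h_k(\cdot)=g_k(\cdot)+\frac{\delta\lambda}2\|\cdot-\tilde w_k^{(r)}\|^2$ and $f_i^*$ replaced by $\psi_i(\cdot)=f_i^*(\cdot)+\frac{\delta\gamma_i}2\|\cdot-\tilde\alpha_i^{(r)}\|^2$ in the proximal mappings, as follows. In every iteration of either routine, $j\in\{1,\ldots,m\}$ is drawn with distribution $p$ and $l\in\{1,\ldots,n\}$ with distribution $q$, independently of each other and of the past, and then the coordinate update is: $\alpha_j^{(t+1)}=\mathbf{prox}_{\sigma_j\psi_j}(\alpha_j^{(t)}+\sigma_ju_j^{(t+1)})$, $\alpha_i^{(t+1)}=\alpha_i^{(t)}$ for $i\neq j$, $w_l^{(t+1)}=\mathbf{prox}_{\tau_lh_l}(w_l^{(t)}-\tau_lv_l^{(t+1)})$, $w_k^{(t+1)}=w_k^{(t)}$ for $k\neq l$, with $u_j^{(t+1)},v_l^{(t+1)}$ specified below. DSCOVR-SVRG$(\bar w^{(0)},\bar\alpha^{(0)},S,M)$: for $s=0,\ldots,S-1$: set $\bar u^{(s)}=X\bar w^{(s)}$, $\bar v^{(s)}=\frac1mX^T\bar\alpha^{(s)}$, $w^{(0)}=\bar w^{(s)}$, $\alpha^{(0)}=\bar\alpha^{(s)}$; for $t=0,\ldots,M-1$ draw $j,l$ and perform the coordinate update with $u_j^{(t+1)}=\bar u_j^{(s)}+\frac1{q_l}X_{jl}(w_l^{(t)}-\bar w_l^{(s)})$ and $v_l^{(t+1)}=\bar v_l^{(s)}+\frac1{p_jm}X_{jl}^T(\alpha_j^{(t)}-\bar\alpha_j^{(s)})$;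 then set $\bar w^{(s+1)}=w^{(M)}$, $\bar\alpha^{(s+1)}=\alpha^{(M)}$. Output $(\bar w^{(S)},\bar\alpha^{(S)})$. DSCOVR-SAGA$(w^{(0)},\alpha^{(0)},M)$: set $\bar u^{(0)}=Xw^{(0)}$, $\bar v^{(0)}=\frac1mX^T\alpha^{(0)}$, $U_{ik}^{(0)}=X_{ik}w_k^{(0)}$, $V_{ik}^{(0)}=\frac1m(\alpha_i^{(0)})^TX_{ik}$; for $t=0,\ldots,M-1$ draw $j,l$ and perform the coordinate update with $u_j^{(t+1)}=\bar u_j^{(t)}-\frac1{q_l}U_{jl}^{(t)}+\frac1{q_l}X_{jl}w_l^{(t)}$ and $v_l^{(t+1)}=\bar v_l^{(t)}-\frac1{p_j}(V_{jl}^{(t)})^T+\frac1{p_jm}X_{jl}^T\alpha_j^{(t)}$; then set $\bar u_j^{(t+1)}=\bar u_j^{(t)}-U_{jl}^{(t)}+X_{jl}w_l^{(t)}$, $\bar v_l^{(t+1)}=\bar v_l^{(t)}-(V_{jl}^{(t)})^T+\frac1mX_{jl}^T\alpha_j^{(t)}$, $U_{jl}^{(t+1)}=X_{jl}w_l^{(t)}$, $V_{jl}^{(t+1)}=\frac1m(X_{jl}^T\alpha_j^{(t)})^T$, all other blocks of $\bar u,\bar v,U,V$ being unchanged. Output $(w^{(M)},\alpha^{(M)})$. The expectation $\mathbf{E}$ is over all random indices in all rounds. *)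

(* Defs.v *)
From HB Require Import structures.
From mathcomp Require Export all_boot all_order all_algebra.
From mathcomp Require Export all_classical all_reals all_analysis.

Set Implicit Arguments.
Unset Strict Implicit.
Unset Printing Implicit Defensive.

Import Order.TTheory GRing.Theory Num.Theory.
Export numFieldNormedType.Exports.

Local Open Scope classical_set_scope.
Local Open Scope ring_scope.

(* Stacked vectors w = [w_1; ...; w_n] are column vectors of size
   \sum_k d k; their blocks are submxcol w k, those of the data matrix X are
   X_ik = submxblock X i k, and its block rows are X_i: = submxcol X i. *)

Section Euclidean.
Variable R : realType.

Definition dotv k (u v : 'cV[R]_k) : R := (u^T *m v) 0 0.

(* The norm `|x| that the library puts on matrices is the sup norm. *)
Definition enorm k (x : 'cV[R]_k) : R := Num.sqrt (\sum_i x i 0 ^+ 2).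

Definition specnorm a b (A : 'M[R]_(a, b)) : R :=
  sup [set enorm (A *m x) | x in [set x : 'cV[R]_b | enorm x <= 1]].

Definition grad k (f : 'cV[R]_k -> R) (x : 'cV[R]_k) : 'cV[R]_k :=
  \col_i ('d (f : 'cV[R]_k -> R^o) x) (delta_mx i 0).

Definition lipschitz_gradient k (c : R) (f : 'cV[R]_k -> R) : Prop :=
  (forall x, differentiable (f : 'cV[R]_k -> R^o) x) /\
  (forall x y, enorm (grad f x - grad f y) <= c * enorm (x - y)).

Definition subdifferential k (g : 'cV[R]_k -> R) (w : 'cV[R]_k) :
    set 'cV[R]_k :=
  [set xi | forall w', g w + dotv xi (w' - w) <= g w'].

(* Convexity is required separately: the inequality alone holds vacuously for
   a function without subgradients. *)
Definition strongly_convex k (lambda : R) (g : 'cV[R]_k -> R) : Prop :=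
  convex_function [set: 'cV[R]_k] g /\
  forall w w' xi, subdifferential g w xi ->
    g w + dotv xi (w' - w) + lambda / 2 * enorm (w' - w) ^+ 2 <= g w'.

Definition conjugate k (f : 'cV[R]_k -> R) (a : 'cV[R]_k) : \bar R :=
  ereal_sup [set (dotv a u - f u)%:E | u in [set: 'cV[R]_k]].

Definition argmin k (F : 'cV[R]_k -> \bar R) : set 'cV[R]_k :=
  [set u | forall u', (F u <= F u')%E].

(* The minimizer is unique when phi is proper, closed and convex; if there is
   no minimizer the value is 0 by convention. *)
Definition prox k (phi : 'cV[R]_k -> \bar R) (v : 'cV[R]_k) : 'cV[R]_k :=
  xget 0 (argmin (fun u => phi u + (2^-1 * enorm (u - v) ^+ 2)%:E)%E).

End Euclidean.

Section Problem.
Variables (R : realType) (m n : nat) (N : 'I_m -> nat) (d : 'I_n -> nat).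

Local Notation primal := 'cV[R]_(\sum_k d k).
Local Notation dual := 'cV[R]_(\sum_i N i).

Definition separable_sum (g : forall k, 'cV[R]_(d k) -> R) (w : primal) : R :=
  \sum_k g k (submxcol w k).

Definition Lagrangian (X : 'M[R]_(\sum_i N i, \sum_k d k))
    (f : forall i, 'cV[R]_(N i) -> R) (g : forall k, 'cV[R]_(d k) -> R)
    (w : primal) (alpha : dual) : \bar R :=
  ((m%:R^-1 * \sum_i dotv (submxcol alpha i) (submxcol X i *m w))%:E
   - (m%:R^-1)%:E * (\sum_i conjugate (f i) (submxcol alpha i))
   + (separable_sum g w)%:E)%E.

Definition saddle_point (L : primal -> dual -> \bar R) (w : primal)
    (alpha : dual) : Prop :=
  forall w' alpha', (L w alpha' <= L w alpha)%E /\ (L w alpha <= L w' alpha)%E.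

Definition Omega (lambda : R) (gamma : 'I_m -> R) (w : primal) (alpha : dual)
    : R :=
  lambda * enorm w ^+ 2
  + m%:R^-1 * \sum_i gamma i * enorm (submxcol alpha i) ^+ 2.

(* In what follows xi t = (j, l) is the pair of indices drawn at iteration t,
   and z = (w, alpha). *)
Section InnerSolvers.
Variables (X : 'M[R]_(\sum_i N i, \sum_k d k)) (p : 'I_m -> R) (q : 'I_n -> R)
  (sigma : 'I_m -> R) (tau : 'I_n -> R)
  (h : forall k, 'cV[R]_(d k) -> R) (psi : forall i, 'cV[R]_(N i) -> \bar R).

(* Only the blocks u j and v l of the two families are used. *)
Definition coord_update (j : 'I_m) (l : 'I_n)
    (u : forall i, 'cV[R]_(N i)) (v : forall k, 'cV[R]_(d k))
    (z : primal * dual) : primal * dual :=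
  (\mxcol_k (if k == l then
               prox (fun x => (tau k * h x)%:E)
                    (submxcol z.1 k - tau k *: v k)
             else submxcol z.1 k),
   \mxcol_i (if i == j then
               prox (fun x => (sigma i)%:E * psi x)%E
                    (submxcol z.2 i + sigma i *: u i)
             else submxcol z.2 i)).

Definition svrg_step (zbar : primal * dual) (j : 'I_m) (l : 'I_n)
    (z : primal * dual) : primal * dual :=
  let ubar : dual := X *m zbar.1 in
  let vbar : primal := m%:R^-1 *: (X^T *m zbar.2) in
  coord_update j l
    (fun i => submxcol ubar i
       + (q l)^-1 *: (submxblock X i l *m (submxcol z.1 l - submxcol zbar.1 l)))
    (fun k => submxcol vbar k
       + (p j * m%:R)^-1 *: ((submxblock X j k)^T
                               *m (submxcol z.2 j - submxcol zbar.2 j)))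
    z.

Fixpoint svrg_stage (xi : nat -> 'I_m * 'I_n) (M : nat) (zbar : primal * dual)
    : primal * dual :=
  if M is t.+1 then
    svrg_step zbar (xi t).1 (xi t).2 (svrg_stage xi t zbar)
  else zbar.

(* Iteration t of stage s uses the draw number s * M + t. *)
Fixpoint dscovr_svrg (xi : nat -> 'I_m * 'I_n) (S M : nat) (z0 : primal * dual)
    : primal * dual :=
  if S is s.+1 then
    svrg_stage (fun t => xi (s * M + t)%N) M (dscovr_svrg xi s M z0)
  else z0.

Record saga_state := SagaState {
  saga_z : primal * dual;
  saga_ubar : dual;
  saga_vbar : primal;
  saga_U : forall (i : 'I_m) (k : 'I_n), 'cV[R]_(N i);
  saga_V : forall (i : 'I_m) (k : 'I_n), 'rV[R]_(d k) }.

Definition saga_init (z : primal * dual) : saga_state :=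
  SagaState z (X *m z.1) (m%:R^-1 *: (X^T *m z.2))
    (fun i k => submxblock X i k *m submxcol z.1 k)
    (fun i k => m%:R^-1 *: ((submxcol z.2 i)^T *m submxblock X i k)).

Definition saga_step (j : 'I_m) (l : 'I_n) (st : saga_state) : saga_state :=
  let: SagaState z ubar vbar U V := st in
  SagaState
    (coord_update j l
       (fun i => submxcol ubar i - (q l)^-1 *: U i l
          + (q l)^-1 *: (submxblock X i l *m submxcol z.1 l))
       (fun k => submxcol vbar k - (p j)^-1 *: (V j k)^T
          + (p j * m%:R)^-1 *: ((submxblock X j k)^T *m submxcol z.2 j))
       z)
    (\mxcol_i (if i == j then
                 submxcol ubar i - U i l + submxblock X i l *m submxcol z.1 l
               else submxcol ubar i))
    (\mxcol_k (if k == l then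
                 submxcol vbar k - (V j k)^T
                 + m%:R^-1 *: ((submxblock X j k)^T *m submxcol z.2 j)
               else submxcol vbar k))
    (fun i k => if (i == j) && (k == l) then
                  submxblock X i k *m submxcol z.1 k
                else U i k)
    (fun i k => if (i == j) && (k == l) then
                  m%:R^-1 *: ((submxblock X i k)^T *m submxcol z.2 i)^T
                else V i k).

Fixpoint saga_iter (xi : nat -> 'I_m * 'I_n) (M : nat) (z0 : primal * dual)
    : saga_state :=
  if M is t.+1 then saga_step (xi t).1 (xi t).2 (saga_iter xi t z0)
  else saga_init z0.

Definition dscovr_saga (xi : nat -> 'I_m * 'I_n) (M : nat) (z0 : primal * dual)
    : primal * dual :=
  saga_z (saga_iter xi M z0).

End InnerSolvers.

Inductive dscovr_option := OptionSVRG | OptionSAGA.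

(* Only used for x >= 0, where absz does not change the value. *)
Definition nceil (x : R) : nat := `|Num.ceil x|%N.

Definition svrg_S (delta : R) : nat :=
  nceil (2 * ln (2 * (1 + delta)) / ln (3 / 2)).
Definition svrg_M (Gamma : R) : nat := nceil (ln 3 * Gamma).
Definition saga_M (delta Gamma : R) : nat :=
  nceil (6 * ln (8 * (1 + delta) / 3) * Gamma).

(* xi r t is the pair of indices drawn at iteration t of round r. *)
Fixpoint acc_dscovr (opt : dscovr_option)
    (X : 'M[R]_(\sum_i N i, \sum_k d k))
    (f : forall i, 'cV[R]_(N i) -> R) (g : forall k, 'cV[R]_(d k) -> R)
    (lambda : R) (gamma : 'I_m -> R) (p : 'I_m -> R) (q : 'I_n -> R)
    (delta Gamma : R) (sigma : 'I_m -> R) (tau : 'I_n -> R)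
    (z0 : primal * dual) (xi : nat -> nat -> 'I_m * 'I_n) (r : nat)
    : primal * dual :=
  if r is r'.+1 then
    let z := acc_dscovr opt X f g lambda gamma p q delta Gamma sigma tau
               z0 xi r' in
    let h k (x : 'cV[R]_(d k)) : R :=
      g k x + delta * lambda / 2 * enorm (x - submxcol z.1 k) ^+ 2 in
    let psi i (x : 'cV[R]_(N i)) : \bar R :=
      (conjugate (f i) x
       + (delta * gamma i / 2 * enorm (x - submxcol z.2 i) ^+ 2)%:E)%E in
    match opt with
    | OptionSVRG =>
        dscovr_svrg X p q sigma tau h psi (xi r')
          (svrg_S delta) (svrg_M Gamma) z
    | OptionSAGA =>
        dscovr_saga X p q sigma tau h psi (xi r') (saga_M delta Gamma) z
    end
  else z0.

End Problem.

Section Randomness.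
Context {disp : measure_display} {T : measurableType disp} {R : realType}.
Variable P : probability T R.

Definition mutually_independent (I : eqType) (F : I -> set (set T)) : Prop :=
  forall (s : seq I) (A : I -> set T), uniq s ->
    (forall i, i \in s -> F i (A i)) ->
    P (\bigcap_(i in [set` s]) A i) = (\prod_(i <- s) P (A i))%E.

Definition sigma_discrete (A : Type) (Y : T -> A) : set (set T) :=
  [set Y @^-1` B | B in [set: set A]].

(* J r t and K r t are the indices j and l drawn at iteration t of round r. *)
Definition independent_draws (m n : nat) (p : 'I_m -> R) (q : 'I_n -> R)
    (J : nat -> nat -> T -> 'I_m) (K : nat -> nat -> T -> 'I_n) : Prop :=
  [/\ forall r t, sigma_discrete (J r t) `<=` measurable
        /\ sigma_discrete (K r t) `<=` measurable,
      forall r t i, P (J r t @^-1` [set i]) = (p i)%:E,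
      forall r t k, P (K r t @^-1` [set k]) = (q k)%:E &
      mutually_independent
        (fun a : ((nat * nat) + (nat * nat))%type =>
           match a with
           | inl rt => sigma_discrete (J rt.1 rt.2)
           | inr rt => sigma_discrete (K rt.1 rt.2)
           end)].

End Randomness.

(* Main.v *)
Require Import Defs.
From mathcomp Require Import ring lra.

(** The conjugate f_i^* is never differentiated: alpha_i is paired with a point
    u such that alpha_i is a subgradient of f_i at u, and strong convexity of
    f_i^* becomes cocoercivity of the subgradients of the smooth function f_i.

    Fix a round with centre z, and let zh be the saddle point of the perturbed
    function.  Its optimality conditions have modulus (1 + delta) times that of
    L, and the step sizes are such that the optimality conditions of the two
    proximal steps, averaged over the draw (j, l), give
      Gamma E|z+ - zh|^2 <= (Gamma - 1)|z - zh|^2 + variance of the estimators,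
    the bilinear coupling terms cancelling because the estimators are unbiased.
    The bound on Gamma makes the variance at most 1/9 (|z - zh|^2 + |zbar - zh|^2)
    for SVRG; for SAGA the table of past products is added to the Lyapunov
    function with weights 3 / (p_i q_k), which is where Gamma >= 1 / (p_i q_k)
    enters.  A whole round then contracts E|. - zh|^2 by (1 / (2 (1 + delta)))^2.
    Finally zh is a proximal point of z, so |zh - z*| <= delta / (1 + delta) |z - z*|
    and |z - zh| <= |z - z*|, and the two rates add up to 1 - 1 / (2 (1 + delta)). *)

Set Implicit Arguments.
Unset Strict Implicit.
Unset Printing Implicit Defensive.

Import Order.TTheory GRing.Theory Num.Theory.

Local Open Scope classical_set_scope.
Local Open Scope ring_scope.

(** The conjugates may be +oo and [prox] is only a chosen minimiser, so every point is pinned down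
    by a subgradient inclusion, and monotonicity compares it with the inclusion at the optimum.
    Existence comes from one source: a finite convex function plus a diagonal quadratic attains its
    minimum on a box. The prox of [g], the prox of the conjugates (by Moreau duality) and the
    perturbed saddle point (once the maximum over alpha is eliminated) are all instances.
    Block-dependent step sizes still give one scalar recursion: with [s = p i * Gamma], a drawn
    block satisfies [s * new <= (s - 1) * old] up to noise and coupling. A block drawn with
    probability [p i] and otherwise frozen then has [Gamma * mean <= (Gamma - 1) * old], whatever
    [i] is. The point zh is random, but it is determined by the draws of earlier rounds. Since a run
    reads finitely many draws, expectations become nested finite sums, and conditioning on the past
    is just the nesting. *)

Lemma eq_ler {R : realType} (x y : R) : x = y -> x <= y.
Proof. by move=> ->. Qed.

(** * Euclidean geometry of block vectors *)

Section InnerProduct.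
Context {R : realType} {k : nat}.
Implicit Types (u v w x y : 'cV[R]_k) (a b c : R).

Lemma dotvE u v : dotv u v = \sum_i u i 0 * v i 0.
Proof. by rewrite /dotv mxE; apply: eq_bigr => i _; rewrite mxE. Qed.

Lemma dotvC u v : dotv u v = dotv v u.
Proof. by rewrite !dotvE; apply: eq_bigr => i _; rewrite mulrC. Qed.

Lemma dotvDl u v w : dotv (u + v) w = dotv u w + dotv v w.
Proof. by rewrite /dotv linearD /= mulmxDl mxE. Qed.

Lemma dotvDr u v w : dotv w (u + v) = dotv w u + dotv w v.
Proof. by rewrite /dotv mulmxDr mxE. Qed.

Lemma dotvNl u w : dotv (- u) w = - dotv u w.
Proof. by rewrite /dotv linearN /= mulNmx mxE. Qed.

Lemma dotvNr u w : dotv w (- u) = - dotv w u.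
Proof. by rewrite /dotv mulmxN mxE. Qed.

Lemma dotvZl a u w : dotv (a *: u) w = a * dotv u w.
Proof. by rewrite /dotv linearZ /= -scalemxAl mxE. Qed.

Lemma dotvZr a u w : dotv w (a *: u) = a * dotv w u.
Proof. by rewrite /dotv -scalemxAr mxE. Qed.

Lemma dotv0l w : dotv 0 w = 0.
Proof. by rewrite /dotv trmx0 mul0mx mxE. Qed.

Lemma dotv0r w : dotv w 0 = 0.
Proof. by rewrite /dotv mulmx0 mxE. Qed.

Definition dotv_linear := (dotvDl, dotvDr, dotvNl, dotvNr, dotvZl, dotvZr).

Lemma dotv_suml (I : finType) (F : I -> 'cV[R]_k) w :
  dotv (\sum_i F i) w = \sum_i dotv (F i) w.
Proof.
by elim/big_rec2: _ => [|i y x _ <-]; rewrite ?dotv0l ?dotvDl.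
Qed.

Lemma dotv_sumr (I : finType) (F : I -> 'cV[R]_k) w :
  dotv w (\sum_i F i) = \sum_i dotv w (F i).
Proof. by rewrite dotvC dotv_suml; apply: eq_bigr => i _; rewrite dotvC. Qed.

Lemma dotv_ge0 x : 0 <= dotv x x.
Proof. by rewrite dotvE sumr_ge0 // => i _; rewrite -expr2 sqr_ge0. Qed.

Lemma dotv_eq0 x : (dotv x x == 0) = (x == 0).
Proof.
apply/eqP/eqP => [|->]; last exact: dotv0l.
rewrite dotvE => /eqP; rewrite psumr_eq0 => [/allP x0|i _]; last first.
  by rewrite -expr2 sqr_ge0.
apply/colP => i; rewrite mxE.
by have /implyP/(_ isT) := x0 i (mem_index_enum _); rewrite -expr2 sqrf_eq0 => /eqP.
Qed.

Lemma enorm_sq x : enorm x ^+ 2 = dotv x x.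
Proof.
rewrite /enorm sqr_sqrtr; last by rewrite sumr_ge0 // => i _; rewrite sqr_ge0.
by rewrite dotvE; apply: eq_bigr => i _; rewrite expr2.
Qed.

Lemma enorm_ge0 x : 0 <= enorm x. Proof. exact: sqrtr_ge0. Qed.

Lemma enormZ a x : enorm (a *: x) = `|a| * enorm x.
Proof.
apply/eqP; rewrite -(@eqrXn2 _ 2) ?mulr_ge0 ?enorm_ge0 //.
by rewrite exprMn !enorm_sq !dotv_linear mulrA -expr2 real_normK ?num_real.
Qed.

Lemma dotv_young c u v : 0 < c ->
  dotv u v <= c * dotv v v + dotv u u / (4 * c).
Proof.
move=> c0; have := dotv_ge0 (u - (2 * c) *: v).
rewrite !dotv_linear (dotvC v u) => h.
rewrite -subr_ge0 -(pmulr_rge0 _ (_ : 0 < 4 * c)) ?mulr_gt0 //.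
apply: le_trans h _; apply: eq_ler.
by field; rewrite gt_eqF.
Qed.

Lemma dotv_youngD c u v : 0 < c ->
  dotv (u + v) (u + v) <= (1 + c) * dotv u u + (1 + c^-1) * dotv v v.
Proof.
move=> c0; have := dotv_ge0 (c *: u - v).
rewrite !dotv_linear (dotvC v u) => h.
rewrite -subr_ge0 -(pmulr_rge0 _ c0).
apply: le_trans h _; apply: eq_ler.
by field; rewrite gt_eqF.
Qed.

Lemma dotv_CS u v : dotv u v <= enorm u * enorm v.
Proof.
have [u0|u0] := eqVneq (dotv u u) 0.
  move/eqP: u0; rewrite dotv_eq0 => /eqP ->.
  by rewrite dotv0l mulr_ge0 // enorm_ge0.
have {}u0 : 0 < dotv u u by rewrite lt_neqAle eq_sym u0 dotv_ge0.
have h := dotv_ge0 (dotv u u *: v - dotv u v *: u).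
have h2 : dotv u v ^+ 2 <= (enorm u * enorm v) ^+ 2.
  rewrite exprMn !enorm_sq -subr_ge0 -(pmulr_rge0 _ u0).
  apply: le_trans h _; rewrite !dotv_linear (dotvC v u); apply: eq_ler; ring.
apply: le_trans (ler_norm _) _.
rewrite -ler_sqr ?nnegrE ?mulr_ge0 ?enorm_ge0 //.
by rewrite real_normK ?num_real.
Qed.

End InnerProduct.

Lemma dotv_mul {R : realType} a b (A : 'M[R]_(a, b)) x y :
  dotv (A *m x) y = dotv x (A^T *m y).
Proof. by rewrite /dotv trmx_mul mulmxA. Qed.

Lemma dotv_mulr {R : realType} a b (A : 'M[R]_(a, b)) x y :
  dotv y (A *m x) = dotv (A^T *m y) x.
Proof. by rewrite dotvC dotv_mul dotvC. Qed.

Lemma dotv_submxcol {R : realType} n (d : 'I_n -> nat)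
    (u v : 'cV[R]_(\sum_k d k)) :
  dotv u v = \sum_k dotv (submxcol u k) (submxcol v k).
Proof.
rewrite /dotv -[u in LHS]submxcolK -[v in LHS]submxcolK tr_mxcol.
rewrite mul_mxrow_mxcol summxE; apply: eq_bigr => i _.
by [].
Qed.

Lemma submxcol_mulmx {R : realType} m n (N : 'I_m -> nat) (d : 'I_n -> nat)
    (X : 'M[R]_(\sum_i N i, \sum_k d k)) (w : 'cV[R]_(\sum_k d k)) i :
  submxcol (X *m w) i = \sum_k submxblock X i k *m submxcol w k.
Proof.
by rewrite -{1}[X]submxblockK -{1}[w]submxcolK mul_mxblock_mxrow mxcolK.
Qed.

Lemma submxcol_mulmxT {R : realType} m n (N : 'I_m -> nat) (d : 'I_n -> nat)
    (X : 'M[R]_(\sum_i N i, \sum_k d k)) (a : 'cV[R]_(\sum_i N i)) k :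
  submxcol (X^T *m a) k = \sum_i (submxblock X i k)^T *m submxcol a i.
Proof.
rewrite submxcol_mulmx; apply: eq_bigr => i _.
by congr (_ *m _); apply/matrixP => s t; rewrite !mxE.
Qed.

Lemma submxcolZ {R : realType} n (d : 'I_n -> nat) c (a : R)
    (A : 'M[R]_(\sum_k d k, c)) k : submxcol (a *: A) k = a *: submxcol A k.
Proof. by apply/matrixP => i j; rewrite !mxE. Qed.

Lemma specnorm_bound {R : realType} a b (A : 'M[R]_(a, b)) x :
  enorm (A *m x) <= specnorm A * enorm x.
Proof.
(* The squared Frobenius norm serves as [C]: it shows the set under [sup] to be bounded, without
   which [sup] would not be an upper bound. *)
have [C C0 hC] : exists2 C : R, 0 <= C &
    forall z, dotv (A *m z) (A *m z) <= C * dotv z z.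
  exists (\sum_i dotv (row i A)^T (row i A)^T).
    by rewrite sumr_ge0 // => i _; exact: dotv_ge0.
  move=> z; rewrite dotvE mulr_suml; apply: ler_sum => i _.
  have -> : (A *m z) i 0 = dotv (row i A)^T z.
    by rewrite /dotv trmxK -row_mul [RHS]mxE.
  rewrite -expr2 -!enorm_sq -exprMn -ler_sqrt ?sqr_ge0 //.
  rewrite !sqrtr_sqr (ger0_norm (mulr_ge0 _ _)) ?enorm_ge0 //.
  rewrite ler_norml dotv_CS andbT lerNl -dotvNl.
  by rewrite (le_trans (dotv_CS _ _)) // -scaleN1r enormZ normrN1 mul1r.
have sS : has_sup [set enorm (A *m x) | x in [set x : 'cV[R]_b | enorm x <= 1]].
  split.
    by exists (enorm (A *m 0)), 0 => //=; rewrite -(scale0r 0) enormZ normr0 mul0r.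
  exists (Num.sqrt C) => _ [z /= z1 <-].
  rewrite -(ger0_norm (enorm_ge0 _)) -sqrtr_sqr ler_sqrt ?enorm_sq //.
  rewrite (le_trans (hC z)) // ler_piMr // -enorm_sq.
  by rewrite exprn_ile1 ?enorm_ge0.
have [x0|x0] := eqVneq (enorm x) 0.
  have -> : x = 0 by apply/eqP; rewrite -dotv_eq0 -enorm_sq x0 expr0n.
  rewrite mulmx0 -(scale0r 0) !enormZ normr0 !mul0r.
  by rewrite (_ : enorm 0 = 0) ?mulr0 // -(scale0r 0) enormZ normr0 mul0r.
have {}x0 : 0 < enorm x by rewrite lt_neqAle eq_sym x0 enorm_ge0.
rewrite -ler_pdivrMr // mulrC -(@ger0_norm _ (enorm x)^-1) ?invr_ge0 ?enorm_ge0 //.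
rewrite -enormZ scalemxAr.
apply: sup_upper_bound => //; exists ((enorm x)^-1 *: x) => //=.
by rewrite enormZ ger0_norm ?invr_ge0 ?enorm_ge0 // mulVf ?gt_eqF.
Qed.

Lemma specnorm_dotv {R : realType} a b (A : 'M[R]_(a, b)) x :
  dotv (A *m x) (A *m x) <= specnorm A ^+ 2 * dotv x x.
Proof.
rewrite -!enorm_sq -exprMn; have h := specnorm_bound A x.
by rewrite ler_sqr ?nnegrE ?enorm_ge0 // (le_trans (enorm_ge0 _) h).
Qed.

(** With [z = A^T *m y], moving [A] across the product gives |z|^2 = <A z, y> <= |A| |z| |y|;
    dividing by |z| avoids comparing the spectral norms of [A] and its transpose. *)
Lemma specnorm_dotvT {R : realType} a b (A : 'M[R]_(a, b)) y :
  dotv (A^T *m y) (A^T *m y) <= specnorm A ^+ 2 * dotv y y.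
Proof.
set z := A^T *m y.
have h : dotv z z <= specnorm A * enorm z * enorm y.
  rewrite {2}/z -dotv_mul (le_trans (dotv_CS _ _)) //.
  by rewrite ler_wpM2r ?enorm_ge0 ?specnorm_bound.
have [z0|z0] := eqVneq (enorm z) 0.
  by rewrite -enorm_sq z0 expr0n mulr_ge0 ?sqr_ge0 ?dotv_ge0.
have {}z0 : 0 < enorm z by rewrite lt_neqAle eq_sym z0 enorm_ge0.
have {}h : enorm z <= specnorm A * enorm y.
  by rewrite -(ler_pM2r z0) -expr2 enorm_sq mulrAC.
rewrite -!enorm_sq -exprMn ler_sqr ?nnegrE ?enorm_ge0 //.
exact: le_trans (enorm_ge0 z) h.
Qed.

(** * Importance-sampled estimators with control variates *)

Section ImportanceSampling.
Context {R : realType} {k : nat} {I : finType}.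
Variables (mu : I -> R) (A B : I -> 'cV[R]_k).
Hypotheses (mu_gt0 : forall l, 0 < mu l) (mu_sum1 : \sum_l mu l = 1).

(** Estimator of the sum of the [A l] from one sampled index, with the remembered values [B] as
    control variate. SVRG takes [B] from the snapshot, SAGA from its tables. *)
Let est l := \sum_l B l + (mu l)^-1 *: (A l - B l).

Lemma estimator_mean w : \sum_l mu l * dotv (est l) w = dotv (\sum_l A l) w.
Proof.
under eq_bigr => l _.
  rewrite !dotv_linear mulrDr mulrA divff ?gt_eqF // mul1r; over.
rewrite big_split /= -mulr_suml mu_sum1 mul1r sumrB /= !dotv_suml; ring.
Qed.

(** The estimator is the sum of [(mu l)^-1 *: A l] and the centred variable [S - (mu l)^-1 *: B l].
    The factor 2 is the price of separating them; centring contributes [- dotv S S], which is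
    dropped. *)
Lemma estimator_second_moment :
  \sum_l mu l * dotv (est l) (est l)
    <= 2 * \sum_l (dotv (A l) (A l) + dotv (B l) (B l)) / mu l.
Proof.
set S := \sum_l B l.
have h l : mu l * dotv (est l) (est l) <= 2 * (dotv (A l) (A l) / mu l)
    + 2 * (mu l * dotv S S - 2 * dotv S (B l) + dotv (B l) (B l) / mu l).
  have -> : est l = (mu l)^-1 *: A l + (S - (mu l)^-1 *: B l).
    by rewrite /est scalerBr addrCA.
  have := @dotv_youngD _ _ 1 ((mu l)^-1 *: A l) (S - (mu l)^-1 *: B l) ltr01.
  rewrite -(ler_pM2l (mu_gt0 l)) => /le_trans; apply.
  rewrite !dotv_linear (dotvC (B l) S); apply: eq_ler.
  by field; rewrite gt_eqF.
apply: le_trans (ler_sum _ (fun l _ => h l)) _.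
rewrite big_split /= -!mulr_sumr -mulrDr ler_pM2l // big_split /=.
rewrite sumrB -mulr_suml -mulr_sumr mu_sum1 -dotv_sumr -/S.
under [leRHS]eq_bigr do rewrite mulrDl.
rewrite [leRHS]big_split /=; have := dotv_ge0 S; lra.
Qed.

(* Young's inequality trades the estimator noise against the term
   - |x l - a|^2 left over by the proximal step. *)
Lemma half_step (c s : R) (a ah : 'cV[R]_k) (x : I -> 'cV[R]_k) :
  0 < c -> 1 < s ->
  (forall l, c * s * dotv (x l - ah) (x l - ah)
     <= c * (s - 1) * (dotv (a - ah) (a - ah) - dotv (x l - a) (x l - a))
        + dotv (est l) (x l - ah)) ->
  c * s * \sum_l mu l * dotv (x l - ah) (x l - ah)
    <= c * (s - 1) * dotv (a - ah) (a - ah)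
       + 2 * (\sum_l (dotv (A l) (A l) + dotv (B l) (B l)) / mu l
              / (4 * (c * (s - 1))))
       + dotv (\sum_l A l) (a - ah).
Proof.
move=> c0 s1 hx; set e := c * (s - 1).
have e0 : 0 < e by rewrite mulr_gt0 // subr_gt0.
have h l : mu l * (c * s * dotv (x l - ah) (x l - ah)) <=
    mu l * (e * dotv (a - ah) (a - ah))
    + mu l * dotv (est l) (est l) / (4 * e) + mu l * dotv (est l) (a - ah).
  rewrite -[_ / _]mulrA -!mulrDr ler_pM2l // (le_trans (hx l)) //.
  have := dotv_young (est l) (x l - a) e0.
  have -> : x l - ah = (x l - a) + (a - ah) by rewrite addrA subrK.
  by rewrite (dotvDr (x l - a)) mulrBr -/e; lra.
rewrite mulr_sumr (eq_bigr (fun l => mu l * (c * s * dotv (x l - ah) (x l - ah)))).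
  apply: le_trans (ler_sum _ (fun l _ => h l)) _.
  rewrite !big_split /= -mulr_suml mu_sum1 mul1r estimator_mean lerD2r lerD2l.
  rewrite -!mulr_suml mulrA ler_pM2r ?invr_gt0 ?(mulr_gt0 _ e0) //.
  exact: estimator_second_moment.
by move=> l _; rewrite mulrCA.
Qed.

End ImportanceSampling.

(** * Proximal points of convex functions *)

Section Convexity.
Context {R : realType}.

Lemma convex_functionP k (g : 'cV[R]_k -> R) :
  convex_function [set: 'cV[R]_k] g <->
  (forall (t : R) x y, 0 <= t -> t <= 1 ->
    g (t *: x + (1 - t) *: y) <= t * g x + (1 - t) * g y).
Proof.
split=> [cg t x y t0 t1|cg t x y _ _].
  exact: (cg (Itv01 t0 t1) x y (mem_set I) (mem_set I)).
by apply: cg; [exact: ge0|exact: le1].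
Qed.

(** A point of the cube is a convex combination of two points whose coordinate [a] is moved by +1 or
    -1. Treating the coordinates one at a time bounds [g] by its values at the vertices; the base
    point [y] has to vary in the induction. *)
Lemma convex_bounded_cube k (g : 'cV[R]_k -> R) (x : 'cV[R]_k) :
  convex_function [set: 'cV[R]_k] g ->
  exists M, forall h : 'cV[R]_k, (forall i, `|h i 0| <= 1) -> g (x + h) <= M.
Proof.
move=> /convex_functionP cg.
suff H (s : seq 'I_k) y : exists M, forall h : 'cV[R]_k,
    (forall i, `|h i 0| <= 1) ->
    g (y + \sum_(i <- s) h i 0 *: delta_mx i 0) <= M.
  have [M hM] := H (index_enum 'I_k) x; exists M => h /hM.
  suff -> : \sum_i h i 0 *: delta_mx i 0 = h by [].
  by rewrite [RHS]matrix_sum_delta; apply: eq_bigr => i _; rewrite big_ord1.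
elim: s y => [|a s IH] y.
  by exists (g y) => h _; rewrite big_nil addr0.
have [M1 hM1] := IH (y + delta_mx a 0); have [M2 hM2] := IH (y - delta_mx a 0).
exists (Num.max M1 M2) => h h1; rewrite big_cons.
set S := \sum_(i <- s) _.
have := h1 a; rewrite ler_norml => /andP[ha1 ha2].
have -> : y + (h a 0 *: delta_mx a 0 + S) =
   ((1 + h a 0) / 2) *: (y + delta_mx a 0 + S)
   + (1 - (1 + h a 0) / 2) *: (y - delta_mx a 0 + S).
  by apply/colP => i; rewrite !mxE; lra.
apply: le_trans (cg _ _ _ _ _) _; [lra|lra|].
have m1 : g (y + delta_mx a 0 + S) <= Num.max M1 M2.
  by rewrite le_max hM1.
have m2 : g (y - delta_mx a 0 + S) <= Num.max M1 M2.
  by rewrite le_max hM2 ?orbT.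
have t0 : 0 <= (1 + h a 0) / 2 by lra.
have t1 : 0 <= 1 - (1 + h a 0) / 2 by lra.
have := lerD (ler_wpM2l t0 m1) (ler_wpM2l t1 m2).
lra.
Qed.

(** The upper bound on a cube yields a local Lipschitz estimate by two uses of convexity: [x + h]
    lies between [x] and [x + t^-1 *: h], and [x] lies between [x + h] and [x - t^-1 *: h]. Row
    vectors match the extreme value theorem applied below. *)
Lemma convex_continuous k (g : 'cV[R]_k -> R) :
  convex_function [set: 'cV[R]_k] g ->
  continuous (fun v : 'rV[R]_k => g v^T).
Proof.
move=> cg v; have [M hM] := convex_bounded_cube v^T cg.
move/convex_functionP: cg => cg.
set x := v^T; set B := M - g x.
have B0 : 0 <= B.
  by rewrite subr_ge0 -[x]addr0 hM // => i; rewrite mxE normr0 ler01.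
have bound (t : R) (h : 'cV[R]_k) : 0 < t -> t <= 1 ->
    (forall i, `|h i 0| <= t) -> `|g x - g (x + h)| <= t * B.
  move=> t0 t1 ht.
  have hk i : `|(t^-1 *: h) i 0| <= 1.
    by rewrite mxE normrM gtr0_norm ?invr_gt0 // mulrC ler_pdivrMr // mul1r.
  have h1 : g (x + h) <= t * M + (1 - t) * g x.
    have -> : x + h = t *: (x + t^-1 *: h) + (1 - t) *: x.
      by apply/colP => i; rewrite !mxE; field; rewrite gt_eqF.
    apply: le_trans (cg _ _ _ (ltW t0) t1) _.
    by rewrite lerD2r ler_pM2l // hM.
  have h2 : g x <= (1 + t)^-1 * g (x + h) + (1 - (1 + t)^-1) * M.
    have {1}-> : x = (1 + t)^-1 *: (x + h) + (1 - (1 + t)^-1) *: (x - t^-1 *: h).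
      by apply/colP => i; rewrite !mxE; field; rewrite !gt_eqF // addr_gt0.
    have t2 : 0 < (1 + t)^-1 by rewrite invr_gt0 addr_gt0.
    have t3 : (1 + t)^-1 <= 1 by rewrite invf_le1 ?addr_gt0 // lerDl ltW.
    apply: le_trans (cg _ _ _ (ltW t2) t3) _.
    rewrite lerD2l ler_wpM2l ?subr_ge0 // hM // => i.
    by rewrite mxE normrN hk.
  have {}h2 : (1 + t) * g x <= g (x + h) + t * M.
    have tt : 0 < 1 + t by rewrite addr_gt0.
    have := ler_wpM2l (ltW tt) h2; rewrite mulrDr !mulrA mulrBr !mulrV ?unitfE ?gt_eqF //.
    by rewrite !mulr1 mul1r; lra.
  by rewrite ler_norml /B; apply/andP; split; lra.
apply/(@cvgrPdist_le _ _ _ _ (nbhs_filter v)) => e e0.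
pose t := Num.min 1 (e / (B + 1)).
have B1 : 0 < B + 1 by rewrite ltr_wpDl.
have t0 : 0 < t by rewrite lt_min ltr01 divr_gt0.
have t1 : t <= 1 by rewrite ge_min lexx.
near=> w.
have -> : w^T = x + (w^T - x) by rewrite addrC subrK.
apply: le_trans (bound t _ t0 t1 _) _.
  move=> i; rewrite !mxE distrC.
  have /(_ 0 i) : forall a b, ball (v a b) t (w a b).
    by near: w; apply/nbhs_ballP; exists t => //= w [].
  by rewrite /ball /= => /ltW.
have : t <= e / (B + 1) by rewrite ge_min lexx orbT.
rewrite ler_pdivlMr // => /(le_trans _); apply.
by rewrite ler_wpM2l ?ltW // ltrDl.
Unshelve. all: by end_near.
Qed.

(** Stands for the limit t -> 0+ in first-order conditions: an explicit small [t] refutes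
    [L < 0]. *)
Lemma ge0_affine_limit (L Q : R) : 0 <= Q ->
  (forall t, 0 < t -> t <= 1 -> 0 <= L + t * Q) -> 0 <= L.
Proof.
move=> Q0 key; rewrite leNgt; apply/negP => L0.
pose t := Num.min 1 (- L / 2 / (Q + 1)).
have Q1 : 0 < Q + 1 by rewrite ltr_wpDl.
have t0 : 0 < t by rewrite lt_min ltr01 !divr_gt0 // oppr_gt0.
have t1 : t <= 1 by rewrite ge_min lexx.
have t2 : t * (Q + 1) <= - L / 2 by rewrite -ler_pdivlMr // ge_min lexx orbT.
by have := key t t0 t1; lra.
Qed.

Lemma convex_combE (t : R) (a b c : R) :
  t * (a - c) ^+ 2 + (1 - t) * (b - c) ^+ 2
   - (t * a + (1 - t) * b - c) ^+ 2 = t * (1 - t) * (a - b) ^+ 2.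
Proof. by ring. Qed.

(** The inclusion is the optimality condition for the minimiser of [F]. The given subgradient
    provides an affine minorant, hence coercivity. The weights [c] vary with the coordinate because
    the saddle-point problem mixes primal and dual weights. *)
Lemma convex_proximal_point k (g : 'cV[R]_k -> R) x0 xi0
    (c : 'I_k -> R) (b : 'cV[R]_k) :
  convex_function [set: 'cV[R]_k] g -> subdifferential g x0 xi0 ->
  (forall i, 0 < c i) ->
  exists x, subdifferential g x (\col_i (c i * (b i 0 - x i 0))).
Proof.
move=> cvxg sub0 c0.
pose F x := g x + \sum_i c i / 2 * (x i 0 - b i 0) ^+ 2.
have cF : convex_function [set: 'cV[R]_k] F.
  apply/convex_functionP => t x y t0 t1.
  have := (convex_functionP g).1 cvxg t x y t0 t1 => h.
  rewrite /F 2!mulrDr addrACA lerD // !mulr_sumr -big_split /=.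
  apply: ler_sum => i _; rewrite !mxE -subr_ge0.
  have -> : t * (c i / 2 * (x i 0 - b i 0) ^+ 2) +
    (1 - t) * (c i / 2 * (y i 0 - b i 0) ^+ 2) -
    c i / 2 * (t * x i 0 + (1 - t) * y i 0 - b i 0) ^+ 2 =
    c i / 2 * (t * (1 - t) * (x i 0 - y i 0) ^+ 2).
    by rewrite -(convex_combE t (x i 0) (y i 0) (b i 0)); ring.
  apply: mulr_ge0; first by rewrite divr_ge0 // ltW.
  by apply: mulr_ge0 (sqr_ge0 _); rewrite mulr_ge0 ?subr_ge0.
(* Half of the quadratic absorbs the affine minorant, by c/4 s^2 + xi s >= - xi^2 / c; the other
   half, c/4, is left for coercivity. *)
pose C0 := - (g x0 + \sum_i (xi0 i 0 * (b i 0 - x0 i 0) - xi0 i 0 ^+ 2 / c i)).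
have Flow (x : 'cV[R]_k) i : c i / 4 * (x i 0 - b i 0) ^+ 2 - C0 <= F x.
  apply: (@le_trans _ _ (\sum_i c i / 4 * (x i 0 - b i 0) ^+ 2 - C0)).
    rewrite lerD2r (bigD1 i) //= lerDl sumr_ge0 // => j _.
    by apply: mulr_ge0 (sqr_ge0 _); rewrite divr_ge0 // ltW.
  have /(_ x) := sub0; rewrite /subdifferential /= => h.
  apply: le_trans (_ : g x0 + dotv xi0 (x - x0) +
     \sum_i c i / 2 * (x i 0 - b i 0) ^+ 2 <= _); last by rewrite lerD2r.
  rewrite opprK addrCA -addrA lerD2l dotvE -!big_split /=.
  apply: ler_sum => j _; rewrite !mxE -subr_ge0.
  set X := x j 0; set Y := b j 0; set Z := xi0 j 0; set c' := c j.
  have -> : Z * (X - x0 j 0) + c' / 2 * (X - Y) ^+ 2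
    - (c' / 4 * (X - Y) ^+ 2 + (Z * (Y - x0 j 0) - Z ^+ 2 / c'))
    = c'^-1 * (c' / 2 * (X - Y) + Z) ^+ 2.
    by field; rewrite gt_eqF //; exact: c0.
  by apply: mulr_ge0 (sqr_ge0 _); rewrite invr_ge0 ltW //; exact: c0.
(* The summand 1 makes [B i] at least 1, so beyond distance [B i] the squared distance also exceeds
   [B i], and [Flow] puts the value above [F b]. *)
pose B i := 4 * `|F b + C0| / c i + 1.
have B0 i : 0 <= B i.
  by rewrite addr_ge0 // divr_ge0 ?mulr_ge0 // ltW.
pose A := [set v : 'rV[R]_k | forall i, v ord0 i \in `[b i 0 - B i, b i 0 + B i]].
have cA : compact A.
  apply: (@rV_compact _ _ (fun i => `[b i 0 - B i, b i 0 + B i]%classic)).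
  by move=> i; exact: segment_compact.
have Ab : A b^T.
  by move=> i; rewrite mxE in_itv /= lerBlDr !lerDl B0.
have [] := @EVT_min_rV _ _ (fun v : 'rV[R]_k => F v^T) A _ cA _.
- by exists b^T.
- by apply: continuous_subspaceT; exact: convex_continuous.
move=> v _ hv; set x := v^T in hv.
have minF y : F x <= F y.
  have [Ay|nAy] := pselect (A y^T).
    by rewrite -[y]trmxK; apply: hv; exact: mem_set.
  have hb : F x <= F b by rewrite -[b]trmxK; apply: hv; exact: mem_set.
  apply: le_trans hb _; move/existsNP: nAy => [i /negP].
  rewrite mxE -[_ \in _]/(_ <= _ <= _) -ler_distl -ltNge => hi.
  apply: le_trans (Flow y i); rewrite lerBrDr.
  apply: le_trans (ler_norm _) _.
  rewrite -real_normK ?num_real //.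
  have h1 : `|F b + C0| <= c i / 4 * B i.
    rewrite /B mulrDr mulr1.
    have -> : c i / 4 * (4 * `|F b + C0| / c i) = `|F b + C0|.
      by field; rewrite gt_eqF.
    by rewrite lerDl divr_ge0 // ltW.
  apply: le_trans h1 _; rewrite ler_pM2l ?divr_gt0 //.
  have B1 : 1 <= B i by rewrite lerDr divr_ge0 ?mulr_ge0 // ltW.
  rewrite expr2; apply: le_trans (ltW hi) _.
  by rewrite ler_peMl // ltW // (le_lt_trans B1).
exists x => y /=.
pose h := y - x.
(* Minimality against [t *: y + (1 - t) *: x], divided by [t]; letting [t] tend to 0 removes the
   quadratic remainder. *)
have key (t : R) : 0 < t -> t <= 1 ->
    0 <= g y - g x + dotv (\col_i (c i * (x i 0 - b i 0))) h
         + t * (\sum_i c i / 2 * h i 0 ^+ 2).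
  move=> t0 t1; rewrite -(pmulr_rge0 _ t0).
  have := minF (t *: y + (1 - t) *: x).
  have := (convex_functionP g).1 cvxg t y x (ltW t0) t1.
  rewrite /F => h1 h2.
  have h3 : g x + \sum_i c i / 2 * (x i 0 - b i 0) ^+ 2 <= t * g y + (1 - t) * g x +
      \sum_i c i / 2 * ((t *: y + (1 - t) *: x) i 0 - b i 0) ^+ 2.
    by apply: le_trans h2 _; rewrite lerD2r.
  move: h3; rewrite -subr_ge0 => /le_trans; apply; apply: eq_ler.
  have -> : \sum_i c i / 2 * ((t *: y + (1 - t) *: x) i 0 - b i 0) ^+ 2 =
     \sum_i c i / 2 * (x i 0 - b i 0) ^+ 2
     + (t * dotv (\col_i (c i * (x i 0 - b i 0))) h
     + t ^+ 2 * (\sum_i c i / 2 * h i 0 ^+ 2)).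
    rewrite dotvE !mulr_sumr -!big_split /=; apply: eq_bigr => i _.
    by rewrite !mxE; field.
  by ring.
set Q := \sum_i _ in key; set L := g y - g x + _ in key.
have Q0 : 0 <= Q.
  by apply: sumr_ge0 => i _; rewrite mulr_ge0 ?sqr_ge0 // divr_ge0 // ltW.
have L0 : 0 <= L by exact: ge0_affine_limit key.
have -> : \col_i (c i * (b i 0 - x i 0)) = - \col_i (c i * (x i 0 - b i 0)).
  by apply/colP => i; rewrite !mxE; ring.
by rewrite dotvNl -/h; move: L0; rewrite /L; lra.
Qed.

End Convexity.

(** * Smooth convex functions, conjugates and proximal mappings *)

Lemma quadratic_is_derive {R : realType} (a b t : R) :
  is_derive t (1 : R) (fun t : R => t * a + b * t ^+ 2) (a + 2 * b * t).
Proof.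
have h1 : is_derive t (1 : R) (fun s : R => a *: s + b *: (s * s))
    (a *: 1 + b *: (t *: 1 + t *: 1)).
  have h0 := is_derive_id t (1 : R).
  exact: is_deriveD (is_deriveZ a h0) (is_deriveZ b (is_deriveM h0 h0)).
have -> : (fun s : R => s * a + b * s ^+ 2) = (fun s => a *: s + b *: (s * s)).
  by apply/funext => s; rewrite expr2 mulrC.
have -> : a + 2 * b * t = a *: 1 + b *: (t *: 1 + t *: 1).
  by rewrite /GRing.scale /=; ring.
exact: h1.
Qed.

Section Smoothness.
Context {R : realType} {k : nat}.
Implicit Types (f g : 'cV[R]_k -> R) (u v x y a b : 'cV[R]_k).

Lemma diff_grad f x h :
  'd (f : 'cV[R]_k -> R^o) x h = dotv (grad f x) h.
Proof.
rewrite dotvE [h in LHS]matrix_sum_delta linear_sum; apply: eq_bigr => i _.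
by rewrite big_ord1 linearZ /= mxE mulrC.
Qed.

(** Descent lemma. The mean value theorem is applied on [0, 1] to [psi], the restriction of [f] to
    the segment minus the claimed quadratic; the Lipschitz bound makes its derivative
    nonpositive. *)
Lemma smooth_upper_bound (c : R) f u v : lipschitz_gradient c f ->
  f v <= f u + dotv (grad f u) (v - u) + c / 2 * dotv (v - u) (v - u).
Proof.
move=> [df lip]; set h := v - u; set G := grad f u; set D := dotv h h.
pose phi (t : R) : R := f (u + t *: h).
have dphi (t : R) : is_derive t (1 : R) phi (dotv (grad f (u + t *: h)) h).
  have hd : derivable (f : 'cV[R]_k -> R^o) (u + t *: h) h.
    exact: diff_derivable.
  have E : (fun s : R => s^-1 *: (phi (s *: (1 : R) + t) - phi t)) =
    (fun s : R => s^-1 *: ((f (s *: h + (u + t *: h)) : R^o) - f (u + t *: h))).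
    apply/funext => s; rewrite /phi; congr (_ *: (f _ - _)).
    by apply/colP => i; rewrite !mxE /GRing.scale /=; ring.
  split; first by rewrite /derivable; move: hd; rewrite /derivable E.
  rewrite /derive E -[LHS]/('D_h (f : 'cV[R]_k -> R^o) (u + t *: h)).
  by rewrite deriveE // diff_grad.
pose psi (t : R) : R := phi t - (t * dotv G h + c / 2 * D * t ^+ 2).
have dpsi (t : R) : is_derive t (1 : R) psi
   (dotv (grad f (u + t *: h)) h - (dotv G h + c * D * t)).
  have -> : c * D * t = 2 * (c / 2 * D) * t by lra.
  exact: is_deriveB (dphi t) (quadratic_is_derive _ _ _).
have [|t] := @MVT R psi (fun t => dotv (grad f (u + t *: h)) h
   - (dotv G h + c * D * t)) 0 1 ltr01.
  apply: derivable_within_continuous => t _.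
  exact: (@ex_derive _ _ _ _ _ _ _ (dpsi t)).
rewrite in_itv /= => /andP[t0 t1] E.
have tD : t * D = dotv (t *: h) h by rewrite dotvZl.
have : psi 1 - psi 0 <= 0.
  rewrite E subr0 mulr1 opprD addrA subr_le0 -dotvNl -dotvDl.
  apply: le_trans (dotv_CS _ _) _.
  apply: le_trans (ler_wpM2r (enorm_ge0 _) (lip _ _)) _.
  have -> : u + t *: h - u = t *: h by rewrite addrC addKr.
  rewrite enormZ gtr0_norm // /D -enorm_sq; apply: eq_ler.
  ring.
have uh : u + h = v by rewrite addrC subrK.
have -> : psi 1 = f v - (dotv G h + c / 2 * D).
  by rewrite /psi /phi scale1r uh mul1r expr1n mulr1.
have -> : psi 0 = f u.
  by rewrite /psi /phi scale0r addr0 mul0r expr2 !mulr0 addr0 subr0.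
by rewrite subr_le0 lerBlDr addrA.
Qed.

Lemma grad_subdifferential (c : R) f u : 0 <= c ->
  convex_function [set: 'cV[R]_k] f -> lipschitz_gradient c f ->
  subdifferential f u (grad f u).
Proof.
move=> c0 /convex_functionP cf lip v /=; set h := v - u; set G := grad f u.
(* Of the constant 3/2, 1/2 comes from the descent lemma started at [u + t *: h], and 1 from
   replacing the gradient there by [G]. *)
rewrite -subr_ge0; apply: (@ge0_affine_limit _ _ (3 / 2 * c * dotv h h)) => [|t t0 t1].
  by rewrite mulr_ge0 ?dotv_ge0 // mulr_ge0 // divr_ge0.
have := smooth_upper_bound (u + t *: h) u lip.
have -> : u - (u + t *: h) = - (t *: h) by rewrite opprD addNKr.
have := cf t v u (ltW t0) t1.
have -> : t *: v + (1 - t) *: u = u + t *: h.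
  by apply/colP => i; rewrite !mxE; ring.
have lipt : dotv (G - grad f (u + t *: h)) h <= c * t * dotv h h.
  apply: le_trans (dotv_CS _ _) _.
  apply: le_trans (ler_wpM2r (enorm_ge0 _) (lip.2 _ _)) _.
  have -> : u - (u + t *: h) = (- t) *: h by rewrite opprD addNKr scaleNr.
  by rewrite enormZ normrN gtr0_norm // -enorm_sq; lra.
have {}lipt := ler_wpM2l (ltW t0) lipt.
rewrite -(pmulr_rge0 _ t0); move: lipt.
move: (grad f (u + t *: h)) (f (u + t *: h)) => G' r; clearbody G h.
rewrite !dotv_linear; lra.
Qed.

Lemma subgradient_upper_bound (c : R) f u v xi : 0 < c ->
  lipschitz_gradient c f -> subdifferential f u xi ->
  f v <= f u + dotv xi (v - u) + c / 2 * dotv (v - u) (v - u).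
Proof.
move=> c0 lip sub.
suff -> : xi = grad f u by exact: smooth_upper_bound.
apply/eqP; rewrite -subr_eq0 -dotv_eq0 eq_le dotv_ge0 andbT.
set h := xi - grad f u.
(* A step of length 1/c along [h], the difference between [xi] and the gradient: the lower bound
   gains |h|^2 / c over the linear part of the upper one, which allows only |h|^2 / (2 c). *)
have := le_trans (sub (u + c^-1 *: h)) (smooth_upper_bound u (u + c^-1 *: h) lip).
have -> : u + c^-1 *: h - u = c^-1 *: h by rewrite addrC addKr.
have -> : xi = h + grad f u by rewrite subrK.
move: (grad f u) (f u) => G r; clearbody h; rewrite !dotv_linear.
have -> : c / 2 * (c^-1 * (c^-1 * dotv h h)) = c^-1 / 2 * dotv h h.
  by field; rewrite gt_eqF.
move=> H; have : c^-1 / 2 * dotv h h <= 0 by lra.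
by rewrite pmulr_rle0 // divr_gt0 // invr_gt0.
Qed.

(* Baillon-Haddad, without assuming that the subgradients are gradients. *)
Lemma subgradient_cocoercive (c : R) f u v xi eta : 0 < c ->
  lipschitz_gradient (1 / c) f ->
  subdifferential f u xi -> subdifferential f v eta ->
  c * dotv (xi - eta) (xi - eta) <= dotv (u - v) (xi - eta).
Proof.
move=> c0 lip.
have c1 : 0 < 1 / c by rewrite div1r invr_gt0.
(* The test point minimises the quadratic upper model of [f] at [u'] minus the affine minorant of
   slope [eta']. Adding the two halves cancels the function values. *)
have half u' v' xi' eta' : subdifferential f u' xi' -> subdifferential f v' eta' ->
    f v' + dotv eta' (u' - v') + c / 2 * dotv (xi' - eta') (xi' - eta') <= f u'.
  move=> hu hv; have := subgradient_upper_bound (u' + c *: (eta' - xi')) c1 lip hu.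
  move/(le_trans (hv _)).
  have -> : u' + c *: (eta' - xi') - u' = c *: (eta' - xi') by rewrite addrC addKr.
  have -> : u' + c *: (eta' - xi') - v' = (u' - v') + c *: (eta' - xi') by rewrite addrAC.
  have -> : 1 / c / 2 * dotv (c *: (eta' - xi')) (c *: (eta' - xi')) =
     c / 2 * dotv (xi' - eta') (xi' - eta').
    by rewrite !dotv_linear; field; rewrite gt_eqF.
  by rewrite !dotv_linear (dotvC eta' xi'); lra.
move=> hu hv; have := half _ _ _ _ hu hv; have := half _ _ _ _ hv hu.
rewrite !dotv_linear !(dotvC u) !(dotvC v) (dotvC eta xi); lra.
Qed.

Lemma conjugate_ge f u (x : 'cV[R]_k) : ((dotv x u - f u)%:E <= conjugate f x)%E.
Proof. by apply: ereal_sup_ubound; exists u. Qed.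

Lemma conjugate_subgradient f u xi : subdifferential f u xi ->
  conjugate f xi = (dotv xi u - f u)%:E.
Proof.
move=> sub; apply/eqP; rewrite eq_le conjugate_ge andbT.
apply: ub_ereal_sup => _ [v _ <-]; rewrite lee_fin.
by have := sub v; rewrite /= dotvDr dotvNr; lra.
Qed.

(** Quadratic growth around [x] both rules out the default branch of [xget] and forces whichever
    minimiser it picks to be [x]. *)
Lemma prox_eq (phi : 'cV[R]_k -> \bar R) v x (r : R) :
  (phi x + (2^-1 * enorm (x - v) ^+ 2)%:E)%E = r%:E ->
  (forall u, (r + 2^-1 * dotv (u - x) (u - x))%:E
      <= phi u + (2^-1 * enorm (u - v) ^+ 2)%:E)%E ->
  prox phi v = x.
Proof.
move=> hr hu; rewrite /prox; case: xgetP => [y -> ymin|nomin].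
  apply/eqP; rewrite -subr_eq0 -dotv_eq0 eq_le dotv_ge0 andbT.
  have := le_trans (hu _) (ymin x); rewrite hr lee_fin; lra.
case: (nomin x) => u; rewrite hr; apply: le_trans (hu u).
by rewrite lee_fin lerDl mulr_ge0 ?invr_ge0 ?dotv_ge0.
Qed.

Lemma prox_convexE g (tau kappa : R) a v x0 xi0 :
  convex_function [set: 'cV[R]_k] g -> subdifferential g x0 xi0 ->
  0 < tau -> 0 <= kappa ->
  let x := prox (fun x => (tau * (g x + kappa / 2 * enorm (x - a) ^+ 2))%:E) v in
  subdifferential g x (tau^-1 *: (v - x) - kappa *: (x - a)).
Proof.
move=> cg sub0 tau0 kappa0 x.
have c0 : 0 < kappa + tau^-1 by rewrite ltr_wpDl ?invr_gt0.
(* Completing the square merges the perturbation and the proximal term into one quadratic of weight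
   [kappa + tau^-1], centred at the weighted average of [a] and [v]. *)
have [z] := @convex_proximal_point _ _ g x0 xi0 (fun=> kappa + tau^-1)
   ((kappa + tau^-1)^-1 *: (kappa *: a + tau^-1 *: v)) cg sub0 (fun=> c0).
have ->: \col_i ((kappa + tau^-1) *
   (((kappa + tau^-1)^-1 *: (kappa *: a + tau^-1 *: v)) i 0 - z i 0)) =
   tau^-1 *: (v - z) - kappa *: (z - a).
  by apply/colP => i; rewrite !mxE mulrBr mulVKf ?gt_eqF //; ring.
move=> hz; suff -> : x = z by [].
apply: (@prox_eq _ _ _ (tau * (g z + kappa / 2 * enorm (z - a) ^+ 2)
   + 2^-1 * enorm (z - v) ^+ 2)) => [//|u].
rewrite -EFinD lee_fin.
have := ler_wpM2l (ltW tau0) (hz u).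
have -> : u = z + (u - z) by rewrite addrC subrK.
set h := u - z; have -> : z + h - z = h by rewrite addrC addKr.
have sV (r : R) : tau * (tau^-1 * r) = r by rewrite mulVKf ?gt_eqF.
clearbody h; rewrite !enorm_sq !dotv_linear !(dotvC h).
rewrite !(mulrDr tau) !(mulrN tau) !sV.
have := mulr_ge0 (mulr_ge0 (ltW tau0) kappa0) (dotv_ge0 h); lra.
Qed.

(** Moreau duality: a proximal problem is solved for the finite function [f], with the inverse
    weight, and the subgradient [z] found at its solution [y] is the prox of the conjugate. *)
Lemma prox_conjugateE f (sigma kappa : R) a v x0 xi0 :
  convex_function [set: 'cV[R]_k] f -> subdifferential f x0 xi0 ->
  0 < sigma -> 0 <= kappa ->
  let x := prox (fun x => sigma%:E *
    (conjugate f x + (kappa / 2 * enorm (x - a) ^+ 2)%:E))%E v in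
  subdifferential f (sigma^-1 *: (v - x) - kappa *: (x - a)) x.
Proof.
move=> cf sub0 sigma0 kappa0 x.
have c0 : 0 < kappa + sigma^-1 by rewrite ltr_wpDl ?invr_gt0.
have ci0 : 0 < (kappa + sigma^-1)^-1 by rewrite invr_gt0.
have [y] := @convex_proximal_point _ _ f x0 xi0 (fun=> (kappa + sigma^-1)^-1)
   (kappa *: a + sigma^-1 *: v) cf sub0 (fun=> ci0).
set z := \col_i _ => hz.
have yE : y = sigma^-1 *: (v - z) - kappa *: (z - a).
  apply/colP => i; rewrite !mxE.
  by field; rewrite !gt_eqF // ltr_wpDl // mulr_ge0 // ltW.
suff -> : x = z by rewrite -yE.
apply: (@prox_eq _ _ _ (sigma * (dotv z y - f y + kappa / 2 * enorm (z - a) ^+ 2)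
   + 2^-1 * enorm (z - v) ^+ 2)) => [|u].
  by rewrite (conjugate_subgradient hz).
(* The conjugate is bounded below by its affine minorant [dotv u y - f y], which is exact at [z]. *)
apply: (@le_trans _ _ (sigma * (dotv u y - f y + kappa / 2 * enorm (u - a) ^+ 2)
   + 2^-1 * enorm (u - v) ^+ 2)%:E); last first.
  rewrite EFinD leeD2r // EFinM lee_pmul2l // ?lte_fin // EFinD leeD2r //.
  exact: conjugate_ge.
rewrite lee_fin {1 3}yE.
have -> : u = z + (u - z) by rewrite addrC subrK.
set h := u - z; have -> : z + h - z = h by rewrite addrC addKr.
move: (f y) => r; clearbody h z; rewrite !enorm_sq !dotv_linear.
rewrite ?(dotvC z h) ?(dotvC a h) ?(dotvC v h) ?(dotvC v z) ?(dotvC a z).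
have := mulr_ge0 (mulr_ge0 (ltW sigma0) kappa0) (dotv_ge0 h).
have sV (b : R) : sigma * (sigma^-1 * b) = b by rewrite mulVKf ?gt_eqF.
rewrite !(mulrDr sigma) !(mulrN sigma) !sV; lra.
Qed.

End Smoothness.

(** * Saddle points and their perturbations *)

Section BlockReplacement.
Context {R : realType} {n : nat} {d : 'I_n -> nat}.
Implicit Types (w : 'cV[R]_(\sum_k d k)).

Definition set_block w k (x : 'cV[R]_(d k)) : 'cV[R]_(\sum_k d k) :=
  \mxcol_j eqtype.dfwith (submxcol w) x j.

Lemma set_blockE w k (x : 'cV[R]_(d k)) : submxcol (set_block w x) k = x.
Proof. by rewrite mxcolK dfwith_in. Qed.

Lemma set_block_neq w k (x : 'cV[R]_(d k)) j :
  j != k -> submxcol (set_block w x) j = submxcol w j.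
Proof. by move=> jk; rewrite mxcolK dfwith_out // eq_sym. Qed.

Lemma separable_sum_set_block (g : forall k, 'cV[R]_(d k) -> R) w k
    (x : 'cV[R]_(d k)) :
  separable_sum g (set_block w x)
    = separable_sum g w - g k (submxcol w k) + g k x.
Proof.
rewrite /separable_sum (bigD1 k) //= [in RHS](bigD1 k) //= set_blockE.
rewrite (eq_bigr (fun j => g j (submxcol w j))) => [|j jk]; first by ring.
by rewrite set_block_neq.
Qed.

Lemma dotv_set_block u w k (x : 'cV[R]_(d k)) :
  dotv u (set_block w x - w) = dotv (submxcol u k) (x - submxcol w k).
Proof.
rewrite dotv_submxcol (bigD1 k) //= [X in _ + X]big1 => [|j jk].
  by rewrite addr0 submxcolB set_blockE.
by rewrite submxcolB set_block_neq // subrr dotv0r.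
Qed.

Variable (g : forall k, 'cV[R]_(d k) -> R).
Arguments g : clear implicits.

Lemma subdifferential_separable w xi :
  (forall k, subdifferential (g k) (submxcol w k) (submxcol xi k)) ->
  subdifferential (separable_sum g) w xi.
Proof.
move=> h w' /=; rewrite dotv_submxcol /separable_sum -big_split /=.
by apply: ler_sum => k _; rewrite submxcolB; exact: h.
Qed.

Lemma subdifferential_block w xi k :
  subdifferential (separable_sum g) w xi ->
  subdifferential (g k) (submxcol w k) (submxcol xi k).
Proof.
move=> h x /=; have := h (set_block w x).
by rewrite /= dotv_set_block separable_sum_set_block; lra.
Qed.

Lemma convex_block k :
  convex_function [set: 'cV[R]_(\sum_k d k)] (separable_sum g) ->
  convex_function [set: 'cV[R]_(d k)] (g k).
Proof.
move=> /convex_functionP cg; apply/convex_functionP => t x y t0 t1.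
have := cg t (set_block 0 x) (set_block 0 y) t0 t1.
have -> : t *: set_block 0 x + (1 - t) *: set_block 0 y
    = set_block 0 (t *: x + (1 - t) *: y).
  apply/mxcolP => j; rewrite submxcolD.
  rewrite !submxcolZ; have [->|jk] := eqVneq j k; first by rewrite !set_blockE.
  by rewrite !set_block_neq // submxcol0 !scaler0 addr0.
rewrite !separable_sum_set_block; lra.
Qed.

(** Strong convexity is assumed of the whole sum and speaks only at its subgradients. The pair [w0],
    [xi0] fills in the other blocks, so that a subgradient of one [g k] extends to one of the
    sum. *)
Lemma strongly_monotone_block (lambda : R) w0 xi0 k (x y xi eta : 'cV[R]_(d k)) :
  strongly_convex lambda (separable_sum g) ->
  subdifferential (separable_sum g) w0 xi0 ->
  subdifferential (g k) x xi -> subdifferential (g k) y eta ->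
  lambda * dotv (x - y) (x - y) <= dotv (xi - eta) (x - y).
Proof.
move=> [_ sg] sub0.
have half (x' y' xi' : 'cV[R]_(d k)) : subdifferential (g k) x' xi' ->
    g k x' + dotv xi' (y' - x') + lambda / 2 * dotv (y' - x') (y' - x') <= g k y'.
  move=> sub'.
  have sub : subdifferential (separable_sum g) (set_block w0 x') (set_block xi0 xi').
    apply: subdifferential_separable => j.
    have [->|jk] := eqVneq j k; first by rewrite !set_blockE.
    by rewrite !set_block_neq //; exact: subdifferential_block.
  have := sg _ (set_block (set_block w0 x') y') _ sub.
  rewrite enorm_sq !dotv_set_block !separable_sum_set_block submxcolB !set_blockE.
  lra.
move=> hx hy; have := half _ y _ hx; have := half _ x _ hy.
rewrite !dotv_linear (dotvC y x); lra.
Qed.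

End BlockReplacement.

Section Saddle.
Context {R : realType} {m n : nat} {N : 'I_m -> nat} {d : 'I_n -> nat}.
Variables (X : 'M[R]_(\sum_i N i, \sum_k d k))
  (f : forall i, 'cV[R]_(N i) -> R) (g : forall k, 'cV[R]_(d k) -> R)
  (lambda : R) (gamma : 'I_m -> R).
Arguments f : clear implicits.
Arguments g : clear implicits.

Local Notation primal := 'cV[R]_(\sum_k d k).
Local Notation dual := 'cV[R]_(\sum_i N i).

(* Optimality conditions for the saddle point zh of the function L perturbed
   around z with parameter delta; a subgradient of the conjugate of f at alpha
   is encoded as a point at which alpha is a subgradient of f. *)
Definition perturbed_saddle (delta : R) (z zh : primal * dual) : Prop :=
  (forall i, subdifferential (f i)
     (submxcol (X *m zh.1) i
       - (delta * gamma i) *: (submxcol zh.2 i - submxcol z.2 i))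
     (submxcol zh.2 i)) /\
  (forall k, subdifferential (g k) (submxcol zh.1 k)
     (- submxcol (m%:R^-1 *: (X^T *m zh.2)) k
       - (delta * lambda) *: (submxcol zh.1 k - submxcol z.1 k))).

Hypotheses (m_gt0 : (0 < m)%N) (lambda_gt0 : 0 < lambda)
  (gamma_gt0 : forall i, 0 < gamma i)
  (f_convex : forall i, convex_function [set: 'cV[R]_(N i)] (f i))
  (f_smooth : forall i, lipschitz_gradient (1 / gamma i) (f i))
  (g_convex : strongly_convex lambda (separable_sum g)).

Let m0 : 0 < m%:R^-1 :> R. Proof. by rewrite invr_gt0 ltr0n. Qed.

(** Everything is compared with [alpha0], the gradients at [X *m wstar], where Fenchel's equality
    makes the conjugates finite and explicit. *)
Lemma saddle_pointP wstar alphastar :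
  saddle_point (Lagrangian X f g) wstar alphastar ->
  forall z, perturbed_saddle 0 z (wstar, alphastar).
Proof.
move=> sp z.
pose u i := submxcol (X *m wstar) i.
pose a i := grad (f i) (u i).
have sub_a i : subdifferential (f i) (u i) (a i).
  by apply: grad_subdifferential (f_smooth i) => //; rewrite divr_ge0 // ltW.
pose alpha0 : dual := \mxcol_i a i.
have conj0 i : conjugate (f i) (submxcol alpha0 i) = (dotv (a i) (u i) - f i (u i))%:E.
  by rewrite mxcolK; exact: conjugate_subgradient.
have LE w al c : (\sum_i conjugate (f i) (submxcol al i))%E = c%:E ->
    Lagrangian X f g w al =
      (m%:R^-1 * (\sum_i dotv (submxcol al i) (submxcol (X *m w) i))
       - m%:R^-1 * c + separable_sum g w)%:E.
  move=> h; rewrite /Lagrangian h -EFinM -EFinB -EFinD; congr (_ * _ - _ + _)%:E.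
  by apply: eq_bigr => i _; rewrite submxcol_mul.
have s0 : (\sum_i conjugate (f i) (submxcol alpha0 i))%E
    = (\sum_i (dotv (a i) (u i) - f i (u i)))%:E.
  by rewrite -sumEFin; apply: eq_bigr => i _; exact: conj0.
have cfin i : exists c, conjugate (f i) (submxcol alphastar i) = c%:E.
  have low j : (conjugate (f j) (submxcol alphastar j) != -oo)%E.
    rewrite -ltNye; apply: lt_le_trans (conjugate_ge (f j) 0 _).
    exact: ltNyr.
  case E : (conjugate (f i) (submxcol alphastar i)) => [c| |].
  - by exists c.
  (* One infinite conjugate would make L equal to -oo at [alphastar], below its finite value at
     [alpha0]. *)
  - have := (sp wstar alpha0).1; rewrite (LE _ _ _ s0) /Lagrangian.
    have -> : (\sum_i conjugate (f i) (submxcol alphastar i) = +oo)%E.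
      by apply/esum_eqyP => [j _|]; [exact: low|exists i].
    by rewrite gt0_muley ?lte_fin //= leeNy_eq.
  - by have := low i; rewrite E.
have [c hc] := choice cfin.
have sc : (\sum_i conjugate (f i) (submxcol alphastar i))%E = (\sum_i c i)%:E.
  by rewrite -sumEFin; apply: eq_bigr => i _.
split=> /= i.
- rewrite mul0r scale0r subr0.
  (* The Fenchel-Young gaps at [alphastar] are nonnegative, and their sum is nonpositive because
     [alpha0], whose gaps vanish, is no better. So each gap is 0, which is the subgradient
     relation. *)
  have fenchel j : 0 <= f j (u j) - (dotv (submxcol alphastar j) (u j) - c j).
    have := conjugate_ge (f j) (u j) (submxcol alphastar j).
    by rewrite hc lee_fin; lra.
  have eq0 j : f j (u j) - (dotv (submxcol alphastar j) (u j) - c j) = 0.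
    have : \sum_j (f j (u j) - (dotv (submxcol alphastar j) (u j) - c j)) == 0.
      rewrite eq_le sumr_ge0 ?andbT //.
      have := (sp wstar alpha0).1; rewrite (LE _ _ _ s0) (LE _ _ _ sc) lee_fin.
      rewrite lerD2r -!mulrBr ler_pM2l //.
      have -> : \sum_i dotv (submxcol alpha0 i) (submxcol (X *m wstar) i)
          - \sum_i (dotv (a i) (u i) - f i (u i)) = \sum_i f i (u i).
        rewrite -sumrB; apply: eq_bigr => l _; rewrite mxcolK -/(u l); ring.
      by rewrite -sumrB => h; rewrite sumrB subr_le0.
    rewrite psumr_eq0 // => /allP/(_ j (mem_index_enum _))/implyP/(_ isT).
    by move/eqP.
  move=> v /=; have := conjugate_ge (f i) v (submxcol alphastar i).
  rewrite hc lee_fin dotvDr dotvNr -/(u i); have := eq0 i; lra.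
- rewrite mul0r scale0r subr0 -submxcolN; apply: subdifferential_block.
  move=> w' /=; have := (sp w' alphastar).2; rewrite !(LE _ _ _ sc) lee_fin.
  by rewrite -!dotv_submxcol !dotv_mulr !dotv_linear; lra.
Qed.

Hypotheses (wstar : primal) (alphastar : dual)
  (star : forall z, perturbed_saddle 0 z (wstar, alphastar)).

Lemma star_dual i : subdifferential (f i) (submxcol (X *m wstar) i)
  (submxcol alphastar i).
Proof. by have := (star 0).1 i; rewrite mul0r scale0r subr0. Qed.

Lemma star_primal : subdifferential (separable_sum g) wstar
  (- (m%:R^-1 *: (X^T *m alphastar))).
Proof.
apply: subdifferential_separable => k.
by have := (star 0).2 k; rewrite /= mul0r scale0r subr0 submxcolN.
Qed.

(** Maximising over alpha first turns each perturbed conjugate into an infimal convolution: the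
    infimum over e of f(X_i w - e) + <z_i, e> + |e|^2 / (2 delta gamma_i). The saddle point thus
    comes from one minimisation in (w, e), with no minimax theorem. *)
Lemma perturbed_saddle_exists (delta : R) z : 0 < delta ->
  exists zh, perturbed_saddle delta z zh.
Proof.
move=> delta0.
pose K := (\sum_k d k + \sum_i N i)%N.
pose F (w : primal) (a : dual) i (e : 'cV[R]_(N i)) :=
  f i (submxcol (X *m w) i - e) + dotv (submxcol a i) e.
(* Substituting e_i = X_i w - y_i for the argument y_i of f_i makes the
   quadratic part of the joint minimisation diagonal. *)
pose phi (W : 'cV[R]_K) := separable_sum g (usubmx W)
  + m%:R^-1 * \sum_i F (usubmx W) z.2 i (submxcol (dsubmx W) i).
have cphi : convex_function [set: 'cV[R]_K] phi.
  apply/convex_functionP => t x y t0 t1; rewrite /phi.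
  have Eu : usubmx (t *: x + (1 - t) *: y) = t *: usubmx x + (1 - t) *: usubmx y.
    by apply/matrixP => i j; rewrite !mxE.
  have Ed : dsubmx (t *: x + (1 - t) *: y) = t *: dsubmx x + (1 - t) *: dsubmx y.
    by apply/matrixP => i j; rewrite !mxE.
  rewrite Eu Ed.
  have h1 := (convex_functionP _).1 g_convex.1 t (usubmx x) (usubmx y) t0 t1.
  have h2 : \sum_i F (t *: usubmx x + (1 - t) *: usubmx y) z.2 i
       (submxcol (t *: dsubmx x + (1 - t) *: dsubmx y) i)
    <= t * (\sum_i F (usubmx x) z.2 i (submxcol (dsubmx x) i))
     + (1 - t) * \sum_i F (usubmx y) z.2 i (submxcol (dsubmx y) i).
    rewrite !mulr_sumr -big_split /=; apply: ler_sum => i _; rewrite /F.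
    have := (convex_functionP _).1 (@f_convex i) t
      (submxcol (X *m usubmx x) i - submxcol (dsubmx x) i)
      (submxcol (X *m usubmx y) i - submxcol (dsubmx y) i) t0 t1.
    rewrite mulmxDr -!scalemxAr !submxcolD !submxcolZ.
    rewrite !scalerBr addrACA -opprD !dotv_linear; lra.
  have := ler_wpM2l (ltW m0) h2; lra.
have dotv_col_mx (a1 b1 : primal) (a2 b2 : dual) :
    dotv (col_mx a1 a2) (col_mx b1 b2) = dotv a1 b1 + dotv a2 b2.
  by rewrite /dotv tr_col_mx mul_row_col mxE.
(* At (wstar, 0) the w-components from [g] and from the coupling cancel by optimality of [wstar];
   the tilt [z.2] minus the subgradients [alphastar] remains in e. *)
have sub0 : subdifferential phi (col_mx wstar 0)
    (col_mx 0 (m%:R^-1 *: (z.2 - alphastar))).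
  move=> W /=; rewrite /phi col_mxKu col_mxKd.
  set w := usubmx W; set e := dsubmx W.
  have -> : W - col_mx wstar 0 = col_mx (w - wstar) e.
    by rewrite -[W]vsubmxK opp_col_mx add_col_mx oppr0 addr0.
  rewrite dotv_col_mx dotv0l add0r dotvZl.
  have h1 := star_primal w.
  have h2 : \sum_i F wstar z.2 i (submxcol 0 i)
       + \sum_i dotv (submxcol alphastar i) (submxcol (X *m (w - wstar)) i)
       + \sum_i dotv (submxcol (z.2 - alphastar) i) (submxcol e i)
      <= \sum_i F w z.2 i (submxcol e i).
    rewrite -!big_split; apply: ler_sum => i _; rewrite /= /F.
    have := @star_dual i (submxcol (X *m w) i - submxcol e i).
    rewrite /= mulmxBr !submxcolB submxcol0 subr0 !dotv_linear dotv0r; lra.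
  rewrite -!dotv_submxcol in h2 *.
  have := ler_wpM2l (ltW m0) h2; move: h1; rewrite /= dotvNl dotvZl dotv_mulr; lra.
pose c (s : 'I_K) : R := match fintype.split s with
  | inl _ => delta * lambda
  | inr s' => (m%:R * delta * gamma (tagnat.sig1 s'))^-1 end.
have c0 s : 0 < c s.
  rewrite /c; case: (fintype.split s) => s'; first by rewrite mulr_gt0.
  by rewrite invr_gt0 !mulr_gt0 // ltr0n.
have [W hW] := convex_proximal_point (col_mx z.1 0) cphi sub0 c0.
set w := usubmx W in hW; set e := dsubmx W.
have WE : W = col_mx w e by rewrite vsubmxK.
have {}hW w' e' : separable_sum g w + m%:R^-1 * (\sum_i F w z.2 i (submxcol e i))
    - delta * lambda * dotv (w - z.1) (w' - w)
    - \sum_i (m%:R * delta * gamma i)^-1 * dotv (submxcol e i) (submxcol (e' - e) i)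
    <= separable_sum g w' + m%:R^-1 * \sum_i F w' z.2 i (submxcol e' i).
  have := hW (col_mx w' e').
  have -> : \col_s (c s * (col_mx z.1 0 s 0 - W s 0)) =
      col_mx (- (delta * lambda) *: (w - z.1))
        (\mxcol_i (- (m%:R * delta * gamma i)^-1 *: submxcol e i)).
    rewrite WE; apply/colP => s; rewrite !mxE /c.
    case: fintype.splitP => s' _; rewrite !mxE; first by ring.
    by rewrite tagnat.sig2K; ring.
  have -> : col_mx w' e' - W = col_mx (w' - w) (e' - e).
    by rewrite WE opp_col_mx add_col_mx.
  rewrite dotv_col_mx /phi !col_mxKu !col_mxKd -/w -/e => /(le_trans _); apply.
  rewrite -!addrA !lerD2l dotvZl mulNr lerD2l dotv_submxcol -sumrN.
  by apply: ler_sum => i _; rewrite mxcolK dotvZl mulNr.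
(* The eliminated maximiser, recovered from its optimality condition e = delta gamma (alpha -
   z.2). *)
pose al : dual := \mxcol_i (submxcol z.2 i + (delta * gamma i)^-1 *: submxcol e i).
have dg i : delta * gamma i != 0 by rewrite gt_eqF // mulr_gt0.
have mn0 : m%:R != 0 :> R by rewrite gt_eqF // ltr0n.
have alE i : (delta * gamma i) *: (submxcol al i - submxcol z.2 i) = submxcol e i.
  by rewrite mxcolK addrAC subrr add0r scalerA divff // scale1r.
exists (w, al); split => /= i.
- rewrite alE => v /=.
  set y := submxcol (X *m w) i - submxcol e i.
  (* Only block [i] of e moves, with w fixed, so that the argument of [f i] becomes [v]. *)
  have := hW w (set_block e (submxcol (X *m w) i - v)).
  have -> : \sum_j (m%:R * delta * gamma j)^-1 * dotv (submxcol e j)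
        (submxcol (set_block e (submxcol (X *m w) i - v) - e) j)
      = (m%:R * delta * gamma i)^-1 * dotv (submxcol e i) (y - v).
    rewrite (bigD1 i) //= [X in _ + X]big1 => [|j ji].
      by rewrite addr0 submxcolB set_blockE addrAC.
    by rewrite submxcolB set_block_neq // subrr dotv0r mulr0.
  rewrite subrr dotv0r mulr0 subr0.
  rewrite -[\sum_i0 F w z.2 i0 _]/(separable_sum (F w z.2) _).
  rewrite -[\sum_i0 F w z.2 i0 (submxcol (set_block _ _) i0)]/(separable_sum (F w z.2) _).
  rewrite separable_sum_set_block => H.
  have {}H : - (m%:R * delta * gamma i)^-1 * dotv (submxcol e i) (y - v)
      <= m%:R^-1 * (F w z.2 i (submxcol (X *m w) i - v) - F w z.2 i (submxcol e i)).
    by lra.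
  have mr0 : 0 <= m%:R :> R by rewrite ler0n.
  have := ler_wpM2l mr0 H; rewrite [leRHS]mulVKf // /F.
  have -> : m%:R * (- (m%:R * delta * gamma i)^-1 * dotv (submxcol e i) (y - v))
     = - dotv ((delta * gamma i)^-1 *: submxcol e i) (y - v).
    by rewrite dotvZl; field; rewrite mn0 !gt_eqF.
  have -> : submxcol (X *m w) i - (submxcol (X *m w) i - v) = v by rewrite subKr.
  have -> : submxcol (X *m w) i - v = submxcol e i + (y - v).
    by rewrite addrA [_ + y]addrC subrK.
  rewrite -/y mxcolK !dotv_linear; lra.
- rewrite -submxcolN -submxcolB.
  rewrite -submxcolZ -submxcolB; apply: subdifferential_block => w' /=.
  (* Here e moves along with w so that the arguments X w - e of all [f j] stay fixed; only [g] and
     linear terms change. *)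
  have := hW w' (e + X *m (w' - w)).
  have -> : e + X *m (w' - w) - e = X *m (w' - w) by rewrite addrC addKr.
  have FE j : F w' z.2 j (submxcol (e + X *m (w' - w)) j) =
     F w z.2 j (submxcol e j) + dotv (submxcol z.2 j) (submxcol (X *m (w' - w)) j).
    rewrite /F submxcolD dotvDr addrA; congr (f j _ + _ + _).
    rewrite mulmxBr !submxcolB; apply/colP => s; rewrite !mxE; ring.
  clearbody F; rewrite (eq_bigr _ (fun j _ => FE j)) big_split /= mulrDr.
  have E j : m%:R^-1 * dotv (submxcol z.2 j) (submxcol (X *m (w' - w)) j) +
     (m%:R * delta * gamma j)^-1 * dotv (submxcol e j) (submxcol (X *m (w' - w)) j)
     = m%:R^-1 * dotv (submxcol al j) (submxcol (X *m (w' - w)) j).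
    by rewrite mxcolK dotvDl dotvZl; field; rewrite mn0 !gt_eqF.
  have : dotv (m%:R^-1 *: (X^T *m al)) (w' - w) =
    m%:R^-1 * (\sum_j dotv (submxcol z.2 j) (submxcol (X *m (w' - w)) j)) +
    \sum_j (m%:R * delta * gamma j)^-1 * dotv (submxcol e j) (submxcol (X *m (w' - w)) j).
    rewrite mulr_sumr -big_split /= (eq_bigr _ (fun j _ => E j)) -mulr_sumr.
    by rewrite -dotv_submxcol dotvZl dotv_mulr.
  rewrite [dotv (- _ - _) _]dotvDl 2!dotvNl [dotv ((delta * lambda) *: _) _]dotvZl => ->.

  lra.
Qed.

End Saddle.

(** * The weighted norm and the outer proximal-point contraction *)

Section OmegaGeometry.
Context {R : realType} {m n : nat} {N : 'I_m -> nat} {d : 'I_n -> nat}.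
Variables (lambda : R) (gamma : 'I_m -> R).
Hypotheses (lambda_gt0 : 0 < lambda) (gamma_gt0 : forall i, 0 < gamma i).
Local Notation primal := 'cV[R]_(\sum_k d k).
Local Notation dual := 'cV[R]_(\sum_i N i).
Implicit Types (w x : primal) (a b : dual).

Definition Omega_dot w a x b : R :=
  lambda * dotv w x
  + m%:R^-1 * \sum_i gamma i * dotv (submxcol a i) (submxcol b i).

Lemma OmegaE w a : Omega lambda gamma w a = Omega_dot w a w a.
Proof.
rewrite /Omega /Omega_dot enorm_sq; congr (_ + _ * _).
by apply: eq_bigr => i _; rewrite enorm_sq.
Qed.

Lemma Omega_ge0 w a : 0 <= Omega lambda gamma w a.
Proof.
rewrite OmegaE addr_ge0 ?mulr_ge0 ?dotv_ge0 ?invr_ge0 ?ler0n //; first exact: ltW.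
by apply: sumr_ge0 => i _; rewrite mulr_ge0 ?dotv_ge0 // ltW.
Qed.

Lemma OmegaN w a : Omega lambda gamma (- w) (- a) = Omega lambda gamma w a.
Proof.
rewrite !OmegaE /Omega_dot dotvNl dotvNr opprK; congr (_ + _ * _).
by apply: eq_bigr => i _; rewrite submxcolN dotvNl dotvNr opprK.
Qed.

Lemma Omega_scaleD c w a x b :
  Omega lambda gamma (c *: w + x) (c *: a + b)
    = c ^+ 2 * Omega lambda gamma w a + 2 * c * Omega_dot w a x b
      + Omega lambda gamma x b.
Proof.
rewrite !OmegaE /Omega_dot !dotv_linear (dotvC x w).
rewrite (eq_bigr (fun i => c ^+ 2 * (gamma i * dotv (submxcol a i) (submxcol a i))
  + (2 * c * (gamma i * dotv (submxcol a i) (submxcol b i))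
  + gamma i * dotv (submxcol b i) (submxcol b i)))).
  by rewrite !big_split /= -!mulr_sumr; ring.
move=> i _; rewrite submxcolD submxcolZ.
by rewrite !dotv_linear (dotvC (submxcol b i)); ring.
Qed.

Lemma Omega_youngD c w a x b : 0 < c ->
  Omega lambda gamma (w + x) (a + b)
    <= (1 + c) * Omega lambda gamma w a + (1 + c^-1) * Omega lambda gamma x b.
Proof.
move=> c0; rewrite -[w]scale1r -[a]scale1r Omega_scaleD !scale1r.
have := Omega_ge0 (- c *: w + x) (- c *: a + b); rewrite Omega_scaleD => h.
rewrite -subr_ge0 -(pmulr_rge0 _ c0); apply: le_trans h _.
apply: eq_ler.
by field; rewrite gt_eqF.
Qed.

End OmegaGeometry.

Section Contraction.
Context {R : realType} {m n : nat} {N : 'I_m -> nat} {d : 'I_n -> nat}.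
Variables (X : 'M[R]_(\sum_i N i, \sum_k d k))
  (f : forall i, 'cV[R]_(N i) -> R) (g : forall k, 'cV[R]_(d k) -> R)
  (lambda : R) (gamma : 'I_m -> R).
Arguments f : clear implicits.
Arguments g : clear implicits.
Local Notation primal := 'cV[R]_(\sum_k d k).
Local Notation dual := 'cV[R]_(\sum_i N i).
Hypotheses (m_gt0 : (0 < m)%N) (lambda_gt0 : 0 < lambda)
  (gamma_gt0 : forall i, 0 < gamma i)
  (f_smooth : forall i, lipschitz_gradient (1 / gamma i) (f i))
  (g_convex : strongly_convex lambda (separable_sum g))
  (wstar : primal) (alphastar : dual)
  (star : forall z, perturbed_saddle X f g lambda gamma 0 z (wstar, alphastar)).

Lemma subdifferential_strongly_monotone k (x y xi eta : 'cV[R]_(d k)) :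
  subdifferential (g k) x xi -> subdifferential (g k) y eta ->
  lambda * dotv (x - y) (x - y) <= dotv (xi - eta) (x - y).
Proof. exact: strongly_monotone_block g_convex (star_primal star). Qed.

(** The coupling cancels between the primal and dual monotonicity inequalities, leaving |zh -
    zstar|^2 <= delta <z - zh, zh - zstar>. The inner product is therefore nonnegative, and both
    bounds follow by expanding |z - zstar|^2. *)
Lemma perturbed_saddle_contraction (delta : R) z zh : 0 < delta ->
  perturbed_saddle X f g lambda gamma delta z zh ->
  Omega lambda gamma (zh.1 - wstar) (zh.2 - alphastar)
    <= (delta / (1 + delta)) ^+ 2 * Omega lambda gamma (z.1 - wstar) (z.2 - alphastar)
  /\ Omega lambda gamma (zh.1 - z.1) (zh.2 - z.2)
    <= Omega lambda gamma (z.1 - wstar) (z.2 - alphastar).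
Proof.
move=> delta0 [hd hp].
set w := zh.1 - wstar; set al := zh.2 - alphastar.
set x := z.1 - zh.1; set b := z.2 - zh.2.
have m0 : 0 < m%:R^-1 :> R by rewrite invr_gt0 ltr0n.
have Hd : \sum_i gamma i * dotv (submxcol al i) (submxcol al i)
   <= dotv (X *m w) al
      + delta * \sum_i gamma i * dotv (submxcol b i) (submxcol al i).
  rewrite dotv_submxcol mulr_sumr -big_split; apply: ler_sum => i _ /=.
  have := subgradient_cocoercive (gamma_gt0 i) (f_smooth i) (hd i)
    (star_dual star (i:=i)).
  rewrite -submxcolB => /le_trans; apply.
  rewrite /w /b /al mulmxBr !submxcolB.
  by rewrite !dotv_linear; lra.
have Hp : lambda * dotv w w <= - dotv (m%:R^-1 *: (X^T *m al)) w
   + delta * lambda * dotv x w.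
  rewrite !dotv_submxcol !mulr_sumr -sumrN -big_split; apply: ler_sum => k _ /=.
  have hs := subdifferential_block (star_primal star) (k:=k).
  have := subdifferential_strongly_monotone (hp k) hs.
  rewrite -submxcolB => /le_trans; apply.
  rewrite /al mulmxBr (scalerBr m%:R^-1) /x /w !submxcolB submxcolN !dotv_linear; lra.
have key : Omega lambda gamma w al <= delta * Omega_dot lambda gamma x b w al.
  have := ler_wpM2l (ltW m0) Hd; move: Hp.
  by rewrite OmegaE /Omega_dot dotvZl -dotv_mulr (dotvC al); lra.
have E1 : Omega lambda gamma (z.1 - wstar) (z.2 - alphastar) =
    Omega lambda gamma x b + 2 * Omega_dot lambda gamma x b w al
    + Omega lambda gamma w al.
  have := Omega_scaleD lambda gamma 1 x b w al.
  by rewrite !scale1r expr1n mul1r mulr1 !subrKA.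
have E2 : Omega lambda gamma (zh.1 - z.1) (zh.2 - z.2) = Omega lambda gamma x b.
  by rewrite -OmegaN !opprB.
have P0 := Omega_ge0 lambda_gt0 gamma_gt0 w al.
have S0 := Omega_ge0 lambda_gt0 gamma_gt0 x b.
have B0 : 0 <= Omega_dot lambda gamma x b w al.
  by rewrite -(pmulr_rge0 _ delta0); exact: le_trans key.
split; last by rewrite E1 E2; lra.
(* This square replaces Cauchy-Schwarz, so that no square root of Omega appears. *)
have := Omega_ge0 lambda_gt0 gamma_gt0 (- delta *: x + w) (- delta *: b + al).
rewrite Omega_scaleD E1 => h.
have d1 : 0 < (1 + delta) ^+ 2 by rewrite exprn_gt0 // addr_gt0.
rewrite expr_div_n mulrAC ler_pdivlMr //.
have := ler_wpM2l (ltW delta0) key; lra.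
Qed.

End Contraction.

(** * Means over independent draws *)

Section DrawMean.
Context {R : realType} {m n : nat}.
Variables (p : 'I_m -> R) (q : 'I_n -> R).
Hypotheses (p_gt0 : forall i, 0 < p i) (p_sum1 : \sum_i p i = 1)
  (q_gt0 : forall k, 0 < q k) (q_sum1 : \sum_k q k = 1).
Implicit Types F G : 'I_m -> 'I_n -> R.

Definition draw_mean F : R := \sum_j \sum_l p j * q l * F j l.

Lemma draw_meanD F G :
  draw_mean (fun j l => F j l + G j l) = draw_mean F + draw_mean G.
Proof.
rewrite /draw_mean -big_split; apply: eq_bigr => j _ /=.
by rewrite -big_split; apply: eq_bigr => l _ /=; rewrite mulrDr.
Qed.

Lemma draw_meanZ a F : draw_mean (fun j l => a * F j l) = a * draw_mean F.
Proof.
rewrite /draw_mean mulr_sumr; apply: eq_bigr => j _.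
by rewrite mulr_sumr; apply: eq_bigr => l _; rewrite mulrCA.
Qed.

Lemma draw_mean_sum (I : finType) (F : I -> 'I_m -> 'I_n -> R) :
  draw_mean (fun j l => \sum_i F i j l) = \sum_i draw_mean (F i).
Proof.
rewrite /draw_mean [RHS]exchange_big; apply: eq_bigr => j _ /=.
by rewrite [RHS]exchange_big; apply: eq_bigr => l _ /=; rewrite mulr_sumr.
Qed.

Lemma eq_draw_mean F G : (forall j l, F j l = G j l) -> draw_mean F = draw_mean G.
Proof.
by move=> h; rewrite /draw_mean; under eq_bigr do under eq_bigr do rewrite h.
Qed.

Lemma ler_draw_mean F G :
  (forall j l, F j l <= G j l) -> draw_mean F <= draw_mean G.
Proof.
move=> h; rewrite /draw_mean; apply: ler_sum => j _; apply: ler_sum => l _.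
by rewrite ler_wpM2l // mulr_ge0 // ltW.
Qed.

Lemma draw_mean_row (F : 'I_m -> R) :
  draw_mean (fun j _ => F j) = \sum_j p j * F j.
Proof.
rewrite /draw_mean; apply: eq_bigr => j _; rewrite -[RHS]mulr1 -q_sum1 mulr_sumr.
by apply: eq_bigr => l _; rewrite mulrAC.
Qed.

Lemma draw_mean_cst c : draw_mean (fun _ _ => c) = c.
Proof. by rewrite draw_mean_row -mulr_suml p_sum1 mul1r. Qed.

Lemma draw_mean_if_row i (F : 'I_n -> R) c :
  draw_mean (fun j l => if i == j then F l else c)
    = p i * \sum_l q l * F l + (1 - p i) * c.
Proof.
have sumc : \sum_(j | j != i) \sum_l p j * q l * c = (1 - p i) * c.
  under eq_bigr do rewrite -mulr_suml -mulr_sumr q_sum1 mulr1.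
  by rewrite -mulr_suml -p_sum1 [in RHS](bigD1 i) //= addrAC subrr add0r.
rewrite -sumc /draw_mean (bigD1 i) //= eqxx mulr_sumr; congr (_ + _).
  by apply: eq_bigr => l _; rewrite mulrA.
apply: eq_bigr => j ji; apply: eq_bigr => l _.
by rewrite eq_sym (negbTE ji).
Qed.

Lemma draw_mean_if_col k (F : 'I_m -> R) c :
  draw_mean (fun j l => if k == l then F j else c)
    = q k * \sum_j p j * F j + (1 - q k) * c.
Proof.
have sumc : \sum_j \sum_(l | l != k) p j * q l * c = (1 - q k) * c.
  rewrite exchange_big /=.
  under eq_bigr do rewrite -2!mulr_suml p_sum1 mul1r.
  by rewrite -mulr_suml -q_sum1 [in RHS](bigD1 k) //= addrAC subrr add0r.
rewrite -sumc /draw_mean mulr_sumr -big_split; apply: eq_bigr => j _ /=.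
rewrite (bigD1 k) //= eqxx mulrA [q k * _]mulrC; congr (_ + _).
by apply: eq_bigr => l lk; rewrite eq_sym (negbTE lk).
Qed.

Lemma draw_mean_if_cell i k a c :
  draw_mean (fun j l => if (i == j) && (k == l) then a else c)
    = p i * q k * a + (1 - p i * q k) * c.
Proof.
rewrite (@eq_draw_mean _ (fun j l => if i == j then if k == l then a else c else c));
  last by move=> j l; case: (i == j).
rewrite draw_mean_if_row (bigD1 k) //= eqxx.
rewrite (eq_bigr (fun l => q l * c)) => [|l lk]; last by rewrite eq_sym (negbTE lk).
rewrite -mulr_suml.
have -> : \sum_(l | l != k) q l = 1 - q k.
  by rewrite -q_sum1 [in RHS](bigD1 k) //= addrAC subrr add0r.
by ring.
Qed.

End DrawMean.

Section SeqMean.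
Context {R : realType} {m n : nat}.
Variables (p : 'I_m -> R) (q : 'I_n -> R).
Hypotheses (p_gt0 : forall i, 0 < p i) (p_sum1 : \sum_i p i = 1)
  (q_gt0 : forall k, 0 < q k) (q_sum1 : \sum_k q k = 1).
Implicit Types F G : seq ('I_m * 'I_n) -> R.

(* The head of the sequence is the first of the k draws. *)
Fixpoint seq_mean k F : R :=
  if k is k'.+1 then
    draw_mean p q (fun j l => seq_mean k' (fun s => F ((j, l) :: s)))
  else F [::].

Lemma eq_seq_mean k F G : (forall s, size s = k -> F s = G s) ->
  seq_mean k F = seq_mean k G.
Proof.
elim: k F G => [|k IH] F G FG /=; first exact: FG.
by apply: eq_draw_mean => j l; apply: IH => s sk; apply: FG => /=; rewrite sk.
Qed.

Lemma ler_seq_mean k F G : (forall s, size s = k -> F s <= G s) ->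
  seq_mean k F <= seq_mean k G.
Proof.
elim: k F G => [|k IH] F G FG /=; first exact: FG.
apply: ler_draw_mean => // j l; apply: IH => s sk.
by apply: FG => /=; rewrite sk.
Qed.

Lemma seq_mean_cat a b F :
  seq_mean (a + b) F = seq_mean a (fun s => seq_mean b (fun t => F (s ++ t))).
Proof. by elim: a F => [//|a IH] F /=; apply: eq_draw_mean => j l; exact: IH. Qed.

Lemma seq_mean_rcons k F :
  seq_mean k.+1 F
    = seq_mean k (fun s => draw_mean p q (fun j l => F (rcons s (j, l)))).
Proof.
rewrite -addn1 seq_mean_cat; apply: eq_seq_mean => s _ /=.
by apply: eq_draw_mean => j l; rewrite cats1.
Qed.

Lemma seq_meanZ k a F : seq_mean k (fun s => a * F s) = a * seq_mean k F.
Proof.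
elim: k F => [//|k IH] F /=; rewrite -draw_meanZ.
by apply: eq_draw_mean => j l; exact: IH.
Qed.

Lemma seq_meanD k F G : seq_mean k (fun s => F s + G s) = seq_mean k F + seq_mean k G.
Proof.
elim: k F G => [//|k IH] F G /=; rewrite -draw_meanD.
by apply: eq_draw_mean => j l; exact: IH.
Qed.

Lemma seq_mean_cst k c : seq_mean k (fun _ => c) = c.
Proof.
elim: k => [//|k IH] /=; rewrite -[RHS](draw_mean_cst p_sum1 q_sum1).
by apply: eq_draw_mean => j l; exact: IH.
Qed.

End SeqMean.

Section Rounding.
Context {R : realType}.

Lemma nceil_ge (x : R) : x <= (nceil x)%:R.
Proof.
rewrite /nceil; apply: le_trans (Num.Theory.ceil_ge _) _.
by rewrite -[leRHS]/((`|Num.ceil x|%N : int)%:~R) ler_int abszE ler_norm.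
Qed.

Lemma expn_le_expR (x b : R) (k : nat) :
  0 <= 1 - x -> b <= k%:R * x -> (1 - x) ^+ k <= expR (- b).
Proof.
move=> x1 bx; apply: (@le_trans _ _ (expR (- x) ^+ k)).
  by rewrite lerXn2r ?nnegrE ?expR_ge0 // expR_ge1Dx.
by rewrite -expRM_natl ler_expR mulrN lerN2.
Qed.

End Rounding.

(** * Contraction of the inner solvers *)

Section Dscovr.
Context {R : realType} {m n : nat} {N : 'I_m -> nat} {d : 'I_n -> nat}.
Variables (X : 'M[R]_(\sum_i N i, \sum_k d k))
  (f : forall i, 'cV[R]_(N i) -> R) (g : forall k, 'cV[R]_(d k) -> R)
  (lambda : R) (gamma : 'I_m -> R).
Arguments f : clear implicits.
Arguments g : clear implicits.
Local Notation primal := 'cV[R]_(\sum_k d k).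
Local Notation dual := 'cV[R]_(\sum_i N i).
Hypotheses (m_gt0 : (0 < m)%N) (n_gt0 : (0 < n)%N) (lambda_gt0 : 0 < lambda)
  (gamma_gt0 : forall i, 0 < gamma i)
  (f_convex : forall i, convex_function [set: 'cV[R]_(N i)] (f i))
  (f_smooth : forall i, lipschitz_gradient (1 / gamma i) (f i))
  (g_convex : strongly_convex lambda (separable_sum g))
  (wstar : primal) (alphastar : dual)
  (star : forall z, perturbed_saddle X f g lambda gamma 0 z (wstar, alphastar)).
Variables (p : 'I_m -> R) (q : 'I_n -> R) (delta Gamma : R).
Hypotheses (p_gt0 : forall i, 0 < p i) (p_sum1 : \sum_i p i = 1)
  (q_gt0 : forall k, 0 < q k) (q_sum1 : \sum_k q k = 1) (delta_gt0 : 0 < delta)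
  (Gamma_ge : forall i k,
     [/\ (p i)^-1 * (1 + 9 * specnorm (submxblock X i k) ^+ 2
            / (2 * q k * lambda * gamma i * (1 + delta) ^+ 2)) <= Gamma,
         (q k)^-1 * (1 + 9 * n%:R * specnorm (submxblock X i k) ^+ 2
            / (2 * p i * m%:R * lambda * gamma i * (1 + delta) ^+ 2)) <= Gamma
       & (p i * q k)^-1 <= Gamma])
  (pGamma_gt1 : forall i, 1 < p i * Gamma)
  (qGamma_gt1 : forall k, 1 < q k * Gamma).
Variables (sigma : 'I_m -> R) (tau : 'I_n -> R).
Hypotheses
  (sigmaE : forall i,
     sigma i = 1 / (2 * (1 + delta) * gamma i * (p i * Gamma - 1)))
  (tauE : forall k,
     tau k = 1 / (2 * (1 + delta) * lambda * (q k * Gamma - 1))).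
(** Default value for [nth]; the runs below read only positions inside the sequence. *)
Variable draw0 : 'I_m * 'I_n.

Section InnerSolvers.
Variables (z0 zh : primal * dual).
Hypothesis zhP : perturbed_saddle X f g lambda gamma delta z0 zh.

Let h k (x : 'cV[R]_(d k)) : R :=
  g k x + delta * lambda / 2 * enorm (x - submxcol z0.1 k) ^+ 2.
Let psi i (x : 'cV[R]_(N i)) : \bar R :=
  (conjugate (f i) x
   + (delta * gamma i / 2 * enorm (x - submxcol z0.2 i) ^+ 2)%:E)%E.

Let m0 : 0 < m%:R^-1 :> R. Proof. by rewrite invr_gt0 ltr0n. Qed.
Let d0 : 0 < 1 + delta. Proof. exact: addr_gt0. Qed.

(** The weights are the coefficients of the noise in the one-step bound: Young's inequality gives 4
    (1 + delta) gamma_i (p_i Gamma - 1), the second moment gives q_k, and the average in Omega and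
    the division by 1 + delta give the rest. The primal weight has the same origin. *)
Definition dual_weight i k : R :=
  (4 * (1 + delta) ^+ 2 * gamma i * m%:R * q k * (p i * Gamma - 1))^-1.
Definition primal_weight i k : R :=
  (4 * (1 + delta) ^+ 2 * lambda * p i * (q k * Gamma - 1))^-1.
Definition memory i k (b : 'cV[R]_(N i)) (c : 'cV[R]_(d k)) : R :=
  dual_weight i k * dotv b b + primal_weight i k * dotv c c.

Definition primal_gap (z : primal * dual) i k : 'cV[R]_(N i) :=
  submxblock X i k *m (submxcol z.1 k - submxcol zh.1 k).
Definition dual_gap (z : primal * dual) i k : 'cV[R]_(d k) :=
  m%:R^-1 *: ((submxblock X i k)^T *m (submxcol z.2 i - submxcol zh.2 i)).

Lemma dual_weight_gt0 i k : 0 < dual_weight i k.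
Proof.
rewrite invr_gt0; have := pGamma_gt1 i; rewrite -subr_gt0 => h1.
by rewrite !mulr_gt0 ?exprn_gt0 // ltr0n.
Qed.

Lemma primal_weight_gt0 i k : 0 < primal_weight i k.
Proof.
rewrite invr_gt0; have := qGamma_gt1 k; rewrite -subr_gt0 => h1.
by rewrite !mulr_gt0 ?exprn_gt0.
Qed.

Lemma memory_ge0 i k (b : 'cV[R]_(N i)) (c : 'cV[R]_(d k)) : 0 <= memory b c.
Proof.
by rewrite addr_ge0 // mulr_ge0 ?dotv_ge0 // ltW // ?dual_weight_gt0 ?primal_weight_gt0.
Qed.

(** Solved for the spectral norm, the two first bounds on Gamma say that a dual term costs at most
    1/(18 m) of its primal block and a primal term at most 1/(18 n) of its dual block. Each primal
    block occurs m times, each dual block n times. *)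
Lemma current_memory_bound z :
  \sum_i \sum_k memory (primal_gap z i k) (dual_gap z i k)
    <= 18^-1 * Omega lambda gamma (z.1 - zh.1) (z.2 - zh.2).
Proof.
have dual_b i k : dual_weight i k * dotv (primal_gap z i k) (primal_gap z i k)
    <= m%:R^-1 * (18^-1 * (lambda
       * dotv (submxcol (z.1 - zh.1) k) (submxcol (z.1 - zh.1) k))).
  rewrite /primal_gap -submxcolB; set x := submxcol _ k.
  set s2 := specnorm (submxblock X i k) ^+ 2.
  have [h1 _ _] := Gamma_ge i k; have := pGamma_gt1 i; rewrite -subr_gt0 => pg.
  have e0 : 0 < 2 * q k * lambda * gamma i * (1 + delta) ^+ 2.
    by rewrite !mulr_gt0 ?exprn_gt0.
  have {}h1 : 9 * s2 <= 2 * q k * lambda * gamma i * (1 + delta) ^+ 2 * (p i * Gamma - 1).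
    move: h1; rewrite mulrC ler_pdivrMr // [Gamma * _]mulrC -lerBrDl.
    by rewrite ler_pdivrMr // => h1; rewrite [leRHS]mulrC.
  rewrite /dual_weight mulrC ler_pdivrMr; last by rewrite !mulr_gt0 ?exprn_gt0 // ltr0n.
  apply: le_trans (specnorm_dotv _ _) _; rewrite -/s2.
  have -> : m%:R^-1 * (18^-1 * (lambda * dotv x x)) *
      (4 * (1 + delta) ^+ 2 * gamma i * m%:R * q k * (p i * Gamma - 1))
      = (2 * q k * lambda * gamma i * (1 + delta) ^+ 2 * (p i * Gamma - 1)) / 9
        * dotv x x.
    by field; rewrite pnatr_eq0 -lt0n.
  by rewrite ler_wpM2r ?dotv_ge0 // ler_pdivlMr // mulrC.
have primal_b i k : primal_weight i k * dotv (dual_gap z i k) (dual_gap z i k)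
    <= n%:R^-1 * (18^-1 * (m%:R^-1 * (gamma i
       * dotv (submxcol (z.2 - zh.2) i) (submxcol (z.2 - zh.2) i)))).
  rewrite /dual_gap -submxcolB; set x := submxcol _ i.
  set s2 := specnorm (submxblock X i k) ^+ 2.
  have [_ h1 _] := Gamma_ge i k; have := qGamma_gt1 k; rewrite -subr_gt0 => pg.
  have e0 : 0 < 2 * p i * m%:R * lambda * gamma i * (1 + delta) ^+ 2.
    by rewrite !mulr_gt0 ?exprn_gt0 ?ltr0n.
  have {}h1 : 9 * n%:R * s2 <=
      2 * p i * m%:R * lambda * gamma i * (1 + delta) ^+ 2 * (q k * Gamma - 1).
    move: h1; rewrite mulrC ler_pdivrMr // [Gamma * _]mulrC -lerBrDl.
    by rewrite ler_pdivrMr // => h1; rewrite [leRHS]mulrC.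
  rewrite /primal_weight mulrC ler_pdivrMr; last by rewrite !mulr_gt0 ?exprn_gt0.
  rewrite dotvZl dotvZr.
  have n0 : 0 < n%:R :> R by rewrite ltr0n.
  have mm : 0 <= (m%:R^-1 : R) by rewrite ltW.
  apply: le_trans (ler_wpM2l mm (ler_wpM2l mm (specnorm_dotvT _ _))) _; rewrite -/s2.
  have -> : n%:R^-1 * (18^-1 * (m%:R^-1 * (gamma i * dotv x x))) *
      (4 * (1 + delta) ^+ 2 * lambda * p i * (q k * Gamma - 1))
      = m%:R^-1 * (m%:R^-1 * ((2 * p i * m%:R * lambda * gamma i * (1 + delta) ^+ 2
          * (q k * Gamma - 1)) / (9 * n%:R) * dotv x x)).
    by field; rewrite !pnatr_eq0 -!lt0n n_gt0.
  rewrite ler_pM2l // ler_pM2l //.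
  by rewrite ler_wpM2r ?dotv_ge0 // ler_pdivlMr ?mulr_gt0 // mulrC.
apply: le_trans (ler_sum _ (fun i _ =>
  ler_sum _ (fun k _ => lerD (dual_b i k) (primal_b i k)))) _.
under [leLHS]eq_bigr do rewrite big_split /=.
rewrite [leLHS]big_split /= /Omega enorm_sq dotv_submxcol mulrDr; apply: lerD.
  rewrite sumr_const card_ord -!mulr_sumr -[leLHS]mulr_natl mulrA divff ?mul1r //.
  by rewrite pnatr_eq0 -lt0n.
rewrite !mulr_sumr; apply: ler_sum => i _.
rewrite sumr_const card_ord -[leLHS]mulr_natl mulVKf ?enorm_sq //.
by rewrite pnatr_eq0 -lt0n.
Qed.

Section OneStep.
Variables (z : primal * dual)
  (u : 'I_n -> forall i, 'cV[R]_(N i)) (v : 'I_m -> forall k, 'cV[R]_(d k))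
  (B : forall (i : 'I_m) (k : 'I_n), 'cV[R]_(N i))
  (D : forall (i : 'I_m) (k : 'I_n), 'cV[R]_(d k)).
(** Common form of both solvers: the exact product at [zh] plus a control-variate estimator of the
    remaining gap. *)
Hypotheses
  (uE : forall l i, u l i = submxcol (X *m zh.1) i
     + (\sum_k B i k + (q l)^-1 *: (primal_gap z i l - B i l)))
  (vE : forall j k, v j k = submxcol (m%:R^-1 *: (X^T *m zh.2)) k
     + (\sum_i D i k + (p j)^-1 *: (dual_gap z j k - D j k))).

Let ds i : 0 < p i * Gamma - 1. Proof. by rewrite subr_gt0. Qed.
Let qs k : 0 < q k * Gamma - 1. Proof. by rewrite subr_gt0. Qed.

(** Cocoercivity compares the prox point with [zh], and the perturbation raises the modulus to [c].
    Since 1/sigma_i = 2 c (p_i Gamma - 1), polarising <a - x, x - ah> gives the hypothesis of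
    [half_step] with s = p_i Gamma. *)
Lemma dual_half_step i (x := fun l => prox (fun y => (sigma i)%:E * @psi i y)%E
      (submxcol z.2 i + sigma i *: u l i)) (ah := submxcol zh.2 i)
    (a := submxcol z.2 i) (c := (1 + delta) * gamma i) :
  c * (p i * Gamma) * \sum_l q l * dotv (x l - ah) (x l - ah)
    <= c * (p i * Gamma - 1) * dotv (a - ah) (a - ah)
       + 2 * (\sum_l (dotv (primal_gap z i l) (primal_gap z i l)
                      + dotv (B i l) (B i l)) / q l / (4 * (c * (p i * Gamma - 1))))
       + dotv (\sum_l primal_gap z i l) (a - ah).
Proof.
have c0 : 0 < c by rewrite mulr_gt0.
apply: half_step => // l.
have sg0 : 0 < sigma i by rewrite sigmaE div1r invr_gt0 !mulr_gt0.
have k0 : 0 <= delta * gamma i by rewrite mulr_ge0 // ltW.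
have := prox_conjugateE (submxcol z0.2 i) (a + sigma i *: u l i) (@f_convex i)
  (star_dual star (i:=i)) sg0 k0.
rewrite -/(x l) => hx.
have := subgradient_cocoercive (gamma_gt0 i) (f_smooth i) hx (zhP.1 i).
have sV : (sigma i)^-1 = 2 * (c * (p i * Gamma - 1)).
  by rewrite sigmaE div1r invrK /c; ring.
have -> : (sigma i)^-1 *: (a + sigma i *: u l i - x l)
    = (sigma i)^-1 *: (a - x l) + u l i.
  by rewrite addrAC scalerDr scalerA mulVf ?scale1r // gt_eqF.
rewrite sV uE; set est := \sum_k _ + _; clearbody est.
set X0 := submxcol (X *m _) i; clearbody X0.
have -> : c * (p i * Gamma) = c + c * (p i * Gamma - 1) by ring.
rewrite /c; set e := p i * Gamma - 1; rewrite -/ah.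
clearbody a ah; move: (x l) => y; clearbody e.
rewrite !dotv_linear !(dotvC ah y) !(dotvC a y) !(dotvC a ah).
set y0 := submxcol z0.2 i; clearbody y0; lra.
Qed.

Lemma primal_half_step k (x := fun j => prox (fun y => (tau k * @h k y)%:E)
      (submxcol z.1 k - tau k *: v j k)) (wh := submxcol zh.1 k)
    (w := submxcol z.1 k) (c := (1 + delta) * lambda) :
  c * (q k * Gamma) * \sum_j p j * dotv (x j - wh) (x j - wh)
    <= c * (q k * Gamma - 1) * dotv (w - wh) (w - wh)
       + 2 * (\sum_j (dotv (dual_gap z j k) (dual_gap z j k)
                      + dotv (D j k) (D j k)) / p j / (4 * (c * (q k * Gamma - 1))))
       - dotv (\sum_j dual_gap z j k) (w - wh).
Proof.
have c0 : 0 < c by rewrite mulr_gt0.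
(* The primal step descends along [v], so the estimator enters negated; this gives the coupling term
   the sign opposite to the dual one. *)
have := @half_step R (d k) _ p (fun j => - dual_gap z j k) (fun j => - D j k) p_gt0 p_sum1
   c (q k * Gamma) w wh x c0 (qGamma_gt1 k).
rewrite !sumrN dotvNl => H.
have dotvNN a b (w' : 'cV[R]_(d k)) (w2 : 'cV[R]_(d k)) :
    (dotv w' w' + dotv w2 w2) / a / b = (dotv (- w') (- w') + dotv (- w2) (- w2)) / a / b.
  by rewrite !dotvNl !dotvNr !opprK.
rewrite [X in _ + 2 * X](eq_bigr _ (fun j _ => dotvNN _ _ _ _)).
apply: H => j.
have t0 : 0 < tau k by rewrite tauE div1r invr_gt0 !mulr_gt0.
have k0 : 0 <= delta * lambda by rewrite mulr_ge0 // ltW.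
have hstar := subdifferential_block (star_primal star) (k:=k).
have := prox_convexE (submxcol z0.1 k) (w - tau k *: v j k)
  (@convex_block _ _ _ g k g_convex.1) hstar t0 k0.
rewrite -/(x j) => hx.
have := subdifferential_strongly_monotone g_convex star hx (zhP.2 k).
have sV : (tau k)^-1 = 2 * (c * (q k * Gamma - 1)).
  by rewrite tauE div1r invrK /c; ring.
have -> : (tau k)^-1 *: (w - tau k *: v j k - x j)
    = (tau k)^-1 *: (w - x j) - v j k.
  by rewrite addrAC scalerBr scalerA mulVf ?scale1r // gt_eqF.
have -> : - \sum_i D i k + (p j)^-1 *: (- dual_gap z j k - - D j k)
    = - (\sum_i D i k + (p j)^-1 *: (dual_gap z j k - D j k)).
  by rewrite -opprD scalerN -opprD.
rewrite sV vE.
set est := \sum_k _ + _; clearbody est.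
set X0 := submxcol (m%:R^-1 *: _) k; clearbody X0.
have -> : c * (q k * Gamma) = c + c * (q k * Gamma - 1) by ring.
rewrite /c; set e := q k * Gamma - 1; rewrite -/wh.
clearbody w wh; move: (x j) => y; clearbody e.
rewrite !dotv_linear !(dotvC wh y) !(dotvC w y) !(dotvC w wh).
set y0 := submxcol z0.1 k; clearbody y0; lra.
Qed.

(* B and D are the memorised values of the gaps: those of the snapshot for SVRG,
   those of the tables for SAGA. *)
Lemma one_step (next := fun j l => coord_update sigma tau h psi j l (u l) (v j) z) :
  Gamma * draw_mean p q (fun j l =>
      Omega lambda gamma ((next j l).1 - zh.1) ((next j l).2 - zh.2))
    <= (Gamma - 1) * Omega lambda gamma (z.1 - zh.1) (z.2 - zh.2)
       + 2 * (\sum_i \sum_k memory (primal_gap z i k) (dual_gap z i k))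
       + 2 * (\sum_i \sum_k memory (B i k) (D i k)).
Proof.
pose Dd i j l :=
  dotv (submxcol ((next j l).2 - zh.2) i) (submxcol ((next j l).2 - zh.2) i).
pose Dp k j l :=
  dotv (submxcol ((next j l).1 - zh.1) k) (submxcol ((next j l).1 - zh.1) k).
pose Ed i := dotv (submxcol (z.2 - zh.2) i) (submxcol (z.2 - zh.2) i).
pose Ep k := dotv (submxcol (z.1 - zh.1) k) (submxcol (z.1 - zh.1) k).
pose cross i k := dotv (dual_gap z i k) (submxcol (z.1 - zh.1) k).
have Hd i : m%:R^-1 * (Gamma * (gamma i * draw_mean p q (Dd i))) <=
    m%:R^-1 * ((Gamma - 1) * (gamma i * Ed i))
    + 2 * (\sum_k (dual_weight i k * dotv (primal_gap z i k) (primal_gap z i k)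
      + dual_weight i k * dotv (B i k) (B i k)))
    + (1 + delta)^-1 * \sum_k cross i k.
  have -> : draw_mean p q (Dd i) = p i * (\sum_l q l *
      (fun x => dotv (x - submxcol zh.2 i) (x - submxcol zh.2 i))
        (prox (fun y => (sigma i)%:E * @psi i y)%E (submxcol z.2 i + sigma i *: u l i)))
      + (1 - p i) * Ed i.
    rewrite -(draw_mean_if_row p_sum1 q_sum1); apply: eq_draw_mean => j l.
    by rewrite /Dd submxcolB /next /coord_update mxcolK /Ed submxcolB; case: (i == j).
  have := dual_half_step i; rewrite /= => H.
  have -> : \sum_k cross i k = m%:R^-1 *
      dotv (\sum_l primal_gap z i l) (submxcol z.2 i - submxcol zh.2 i).
    rewrite dotv_suml mulr_sumr; apply: eq_bigr => k _.
    by rewrite /cross /dual_gap dotvZl -dotv_mulr dotvC submxcolB.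
  have -> : \sum_k (dual_weight i k * dotv (primal_gap z i k) (primal_gap z i k)
      + dual_weight i k * dotv (B i k) (B i k)) =
      m%:R^-1 * ((1 + delta)^-1 * \sum_k (dotv (primal_gap z i k) (primal_gap z i k)
        + dotv (B i k) (B i k)) / q k / (4 * ((1 + delta) * gamma i * (p i * Gamma - 1)))).
    rewrite !mulr_sumr; apply: eq_bigr => k _; rewrite -mulrDr /dual_weight.
    have ep := ds i; set e := p i * Gamma - 1 in ep *; clearbody e.
    by field; rewrite pnatr_eq0 -lt0n m_gt0 !gt_eqF.
  move: H; set S1 := \sum_l q l * _; set S2 := \sum_l _ / _; set c0 := dotv (\sum_l _) _.
  rewrite -submxcolB -/(Ed i) => H.
  have -> : m%:R^-1 * ((Gamma - 1) * (gamma i * Ed i))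
      + 2 * (m%:R^-1 * ((1 + delta)^-1 * S2)) + (1 + delta)^-1 * (m%:R^-1 * c0)
      = m%:R^-1 * ((Gamma - 1) * (gamma i * Ed i) + (1 + delta)^-1 * (2 * S2 + c0)).
    by ring.
  rewrite ler_pM2l // -(ler_pM2l d0) [leRHS]mulrDr mulVKf ?gt_eqF //.
  lra.
have Hp k : Gamma * (lambda * draw_mean p q (Dp k)) <=
    (Gamma - 1) * (lambda * Ep k)
    + 2 * (\sum_i (primal_weight i k * dotv (dual_gap z i k) (dual_gap z i k)
      + primal_weight i k * dotv (D i k) (D i k)))
    - (1 + delta)^-1 * \sum_i cross i k.
  have -> : draw_mean p q (Dp k) = q k * (\sum_j p j *
      (fun x => dotv (x - submxcol zh.1 k) (x - submxcol zh.1 k))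
        (prox (fun y => (tau k * @h k y)%:E) (submxcol z.1 k - tau k *: v j k)))
      + (1 - q k) * Ep k.
    rewrite -(draw_mean_if_col p_sum1 q_sum1); apply: eq_draw_mean => j l.
    by rewrite /Dp submxcolB /next /coord_update mxcolK /Ep submxcolB; case: (k == l).
  have := primal_half_step k; rewrite /= => H.
  have -> : \sum_i cross i k =
      dotv (\sum_i dual_gap z i k) (submxcol z.1 k - submxcol zh.1 k).
    by rewrite dotv_suml; apply: eq_bigr => i _; rewrite /cross submxcolB.
  have -> : \sum_i (primal_weight i k * dotv (dual_gap z i k) (dual_gap z i k)
      + primal_weight i k * dotv (D i k) (D i k)) =
      (1 + delta)^-1 * \sum_i (dotv (dual_gap z i k) (dual_gap z i k)
        + dotv (D i k) (D i k)) / p i / (4 * ((1 + delta) * lambda * (q k * Gamma - 1))).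
    rewrite !mulr_sumr; apply: eq_bigr => i _; rewrite -mulrDr /primal_weight.
    have ep := qs k; set e := q k * Gamma - 1 in ep *; clearbody e.
    by field; rewrite !gt_eqF.
  move: H; set S1 := \sum_j p j * _; set S2 := \sum_j _ / _; set c0 := dotv (\sum_j _) _.
  rewrite -submxcolB -/(Ep k) => H.
  have -> : (Gamma - 1) * (lambda * Ep k) + 2 * ((1 + delta)^-1 * S2)
      - (1 + delta)^-1 * c0
      = (Gamma - 1) * (lambda * Ep k) + (1 + delta)^-1 * (2 * S2 - c0) by ring.
  rewrite -(ler_pM2l d0) [leRHS]mulrDr mulVKf ?gt_eqF //.
  lra.
have split3 (I : finType) (a b c : I -> R) t :
    \sum_i (a i + 2 * b i + t * c i) = \sum_i a i + 2 * (\sum_i b i) + t * \sum_i c i.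
  by rewrite !big_split /= -!mulr_sumr.
pose Md i k := dual_weight i k * dotv (primal_gap z i k) (primal_gap z i k)
      + dual_weight i k * dotv (B i k) (B i k).
pose Mp i k := primal_weight i k * dotv (dual_gap z i k) (dual_gap z i k)
      + primal_weight i k * dotv (D i k) (D i k).
have {}Hd : m%:R^-1 * (Gamma * \sum_i gamma i * draw_mean p q (Dd i)) <=
    m%:R^-1 * ((Gamma - 1) * \sum_i gamma i * Ed i)
    + 2 * (\sum_i \sum_k Md i k) + (1 + delta)^-1 * \sum_i \sum_k cross i k.
  have := @ler_sum R _ (index_enum 'I_m) xpredT _ _ (fun i _ => Hd i).
  by rewrite split3 -!mulr_sumr.
have {}Hp : Gamma * (lambda * \sum_k draw_mean p q (Dp k)) <=
    (Gamma - 1) * (lambda * \sum_k Ep k)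
    + 2 * (\sum_k \sum_i Mp i k) - (1 + delta)^-1 * \sum_k \sum_i cross i k.
  have Hp' k : Gamma * (lambda * draw_mean p q (Dp k)) <= (Gamma - 1) * (lambda * Ep k)
    + 2 * (\sum_i Mp i k) + - (1 + delta)^-1 * \sum_i cross i k by rewrite mulNr.
  have := @ler_sum R _ (index_enum 'I_n) xpredT _ _ (fun k _ => Hp' k).
  by rewrite split3 -!mulr_sumr mulNr.
have memE : \sum_i \sum_k memory (primal_gap z i k) (dual_gap z i k)
    + \sum_i \sum_k memory (B i k) (D i k)
    = \sum_i \sum_k Md i k + \sum_k \sum_i Mp i k.
  rewrite [\sum_k \sum_i Mp i k]exchange_big -!big_split /=.
  apply: eq_bigr => i _; rewrite -!big_split /=; apply: eq_bigr => k _.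
  by rewrite /memory /Md /Mp; ring.
have crossE : \sum_i \sum_k cross i k = \sum_k \sum_i cross i k.
  exact: exchange_big.
have OE j l : Omega lambda gamma ((next j l).1 - zh.1) ((next j l).2 - zh.2) =
   lambda * (\sum_k Dp k j l) + m%:R^-1 * \sum_i gamma i * Dd i j l.
  by rewrite OmegaE /Omega_dot [dotv (_ - zh.1) _]dotv_submxcol.
have OzE : Omega lambda gamma (z.1 - zh.1) (z.2 - zh.2) =
   lambda * (\sum_k Ep k) + m%:R^-1 * \sum_i gamma i * Ed i.
  by rewrite OmegaE /Omega_dot [dotv (_ - zh.1) _]dotv_submxcol.
rewrite (eq_draw_mean p q OE) draw_meanD !draw_meanZ !draw_mean_sum.
rewrite (eq_bigr _ (fun i _ => draw_meanZ p q (gamma i) (Dd i))) OzE.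
rewrite -addrA -mulrDr memE; move: Hd Hp; rewrite crossE.
by move: (\sum_k Ep k) (\sum_i gamma i * Ed i) (\sum_i \sum_k Md i k)
  (\sum_k \sum_i Mp i k) (\sum_k \sum_i cross i k) => ? ? ? ? ?; lra.
Qed.

End OneStep.

(** * Contraction of DSCOVR-SVRG *)

Local Notation svrg_update := (svrg_step X p q sigma tau h psi).
Local Notation stage := (svrg_stage X p q sigma tau h psi).
Local Notation svrg_run := (dscovr_svrg X p q sigma tau h psi).
Local Notation saga_update := (saga_step X p q sigma tau h psi).
Local Notation saga_run := (saga_iter X p q sigma tau h psi).

Let Om z := Omega lambda gamma (z.1 - zh.1) (z.2 - zh.2).
Let cur z := \sum_i \sum_k memory (primal_gap z i k) (dual_gap z i k).

Let Gamma_gt1 : 1 < Gamma.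
Proof.
have i : 'I_m by exact: draw0.1.
apply: lt_le_trans (pGamma_gt1 i) _; rewrite ler_piMl //.
  have := lt_trans ltr01 (pGamma_gt1 i); rewrite pmulr_rgt0 //; exact: ltW.
by rewrite -p_sum1 (bigD1 i) //= lerDl sumr_ge0 // => j _; exact: ltW.
Qed.

Let Gamma_gt0 : 0 < Gamma. Proof. exact: lt_trans Gamma_gt1. Qed.

Let cur_bound z : cur z <= 18^-1 * Om z.
Proof. exact: current_memory_bound. Qed.

Let Om_ge0 z : 0 <= Om z. Proof. exact: Omega_ge0. Qed.

Lemma svrg_step_mean zbar z :
  Gamma * draw_mean p q (fun j l => Om (svrg_update zbar j l z))
    <= (Gamma - 8 / 9) * Om z + 9^-1 * Om zbar.
Proof.
have := @one_step z
  (fun l i => submxcol (X *m zbar.1) i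
       + (q l)^-1 *: (submxblock X i l *m (submxcol z.1 l - submxcol zbar.1 l)))
  (fun j k => submxcol (m%:R^-1 *: (X^T *m zbar.2)) k
       + (p j * m%:R)^-1 *: ((submxblock X j k)^T
                               *m (submxcol z.2 j - submxcol zbar.2 j)))
  (primal_gap zbar) (dual_gap zbar).
rewrite /= -/(Om z) -/(cur z) -/(cur zbar) => H.
apply: le_trans (H _ _) _ => [l i|j k|].
- rewrite addrA /primal_gap -mulmxBr opprB addrA subrK; congr (_ + _).
  rewrite !submxcol_mulmx -big_split /=; apply: eq_bigr => k _.
  by rewrite -mulmxDr addrC subrK.
- rewrite addrA /dual_gap -scalerBr -mulmxBr opprB addrA subrK.
  rewrite scalerA -invfM; congr (_ + _).
  rewrite !submxcolZ -scaler_sumr -scalerDr !submxcol_mulmxT -big_split /=.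
  congr (_ *: _); apply: eq_bigr => i _.
  by rewrite -mulmxDr addrC subrK.
have := cur_bound z; have := cur_bound zbar; lra.
Qed.

(** A run reads only its first draws; this lets a stream be exchanged for a finite sequence or for a
    part of a longer one. *)
Lemma eq_svrg_stage xi xi' M zbar : (forall t, (t < M)%N -> xi t = xi' t) ->
  stage xi M zbar
    = stage xi' M zbar.
Proof.
elim: M => [//|M IH] e /=; rewrite e // IH // => t tM.
by apply: e; exact: ltnW.
Qed.

(* 7/8 r^M + 1/8 solves the affine recurrence given by svrg_step_mean. *)
Lemma svrg_stage_mean M zbar :
  seq_mean p q M (fun s => Om (stage (nth draw0 s) M zbar))
    <= (7 / 8 * (1 - 8 / (9 * Gamma)) ^+ M + 8^-1) * Om zbar.
Proof.
elim: M => [|M IH]; first by rewrite /= expr0; lra.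
rewrite -(ler_pM2l Gamma_gt0) seq_mean_rcons -seq_meanZ.
set V := fun s => Om (stage (nth draw0 s) M zbar).
apply: (@le_trans _ _ (seq_mean p q M (fun s => (Gamma - 8 / 9) * V s + 9^-1 * Om zbar))).
  apply: ler_seq_mean => // s sM.
  apply: le_trans (svrg_step_mean zbar (stage (nth draw0 s) M zbar)).
  apply: eq_ler; congr (_ * _).
  apply: eq_draw_mean => j l /=; rewrite nth_rcons sM ltnn eqxx /=.
  congr (Om (svrg_step _ _ _ _ _ _ _ _ _ _ _)).
  by apply: eq_svrg_stage => t tM; rewrite nth_rcons sM tM.
rewrite seq_meanD seq_meanZ seq_mean_cst //.
have g8 : 0 <= Gamma - 8 / 9 by have := Gamma_gt1; lra.
have {}IH := ler_wpM2l g8 IH.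
apply: le_trans (lerD IH (lexx _)) _; rewrite exprS; apply: eq_ler.
by field; rewrite gt_eqF.
Qed.

Lemma svrg_stage_contraction zbar :
  seq_mean p q (svrg_M Gamma)
    (fun s => Om (stage (nth draw0 s) (svrg_M Gamma) zbar))
    <= 2 / 3 * Om zbar.
Proof.
apply: le_trans (svrg_stage_mean _ _) _; rewrite ler_wpM2r //.
(* 7/8 * 3/5 + 1/8 = 13/20 is below 2/3. The exponent 8/9 ln 3 is then weakened to 1/2 ln 3, so that
   squaring reduces the claim to 1/3 <= 9/25. *)
suff : (1 - 8 / (9 * Gamma)) ^+ svrg_M Gamma <= 3 / 5.
  by move: (_ ^+ _) => b; lra.
have ln3 : 0 < ln (3 : R) by rewrite ln_gt0 // ltr1n.
apply: le_trans (_ : expR (- (ln 3 / 2)) <= _).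
  apply: expn_le_expR.
    rewrite subr_ge0 ler_pdivrMr ?mulr_gt0 // mul1r; have := Gamma_gt1; lra.
  have := nceil_ge (ln 3 * Gamma); rewrite -/(svrg_M Gamma) => h1.
  have h2 : 0 <= 8 / (9 * Gamma) by rewrite divr_ge0 // mulr_ge0 // ltW.
  apply: le_trans (ler_wpM2r h2 h1).
  have -> : ln 3 * Gamma * (8 / (9 * Gamma)) = ln 3 * (8 / 9).
    by field; rewrite gt_eqF.
  by rewrite ler_pM2l //; lra.
rewrite -ler_sqr ?nnegrE ?expR_ge0 //.
rewrite -expRM_natl.
have -> : 2%:R * - (ln (3 : R) / 2) = - ln 3 by field.
by rewrite expRN lnK ?posrE //; lra.
Qed.

Lemma eq_dscovr_svrg xi xi' S M y : (forall t, (t < S * M)%N -> xi t = xi' t) ->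
  svrg_run xi S M y
    = svrg_run xi' S M y.
Proof.
elim: S => [//|S IH] e /=; rewrite IH => [|t tS]; last first.
  by apply: e; apply: leq_trans tS _; rewrite leq_mul2r leqnSn orbT.
by apply: eq_svrg_stage => t tM; apply: e; rewrite mulSn addnC ltn_add2r.
Qed.

Lemma dscovr_svrg_mean M S z :
  (forall zbar, seq_mean p q M
    (fun s => Om (stage (nth draw0 s) M zbar))
    <= 2 / 3 * Om zbar) ->
  seq_mean p q (S * M) (fun s => Om (svrg_run (nth draw0 s) S M z))
    <= (2 / 3) ^+ S * Om z.
Proof.
move=> HM.
elim: S => [|S IH]; first by rewrite mul0n /= expr0 mul1r.
(* The draws of the last stage are placed at the end: the inner mean is over them, with the snapshot
   fixed by the earlier ones. *)
rewrite mulSn addnC seq_mean_cat exprS -mulrA.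
have c23 : 0 <= 2 / 3 :> R by rewrite divr_ge0.
apply: le_trans (ler_wpM2l c23 IH); rewrite -seq_meanZ.
apply: ler_seq_mean => // s sS; apply: le_trans (HM _).
apply: eq_ler; apply: eq_seq_mean => s' s'M /=.
congr Om; rewrite (@eq_dscovr_svrg _ (nth draw0 s)) => [|t tS]; last first.
  by rewrite nth_cat sS tS.
by apply: eq_svrg_stage => t tM; rewrite nth_cat sS ltnNge leq_addr /= addKn.
Qed.

(** * Contraction of DSCOVR-SAGA *)

Let mem_B (st : saga_state R N d) i k :=
  saga_U st i k - submxblock X i k *m submxcol zh.1 k.
Let mem_D (st : saga_state R N d) i k :=
  (saga_V st i k)^T - m%:R^-1 *: ((submxblock X i k)^T *m submxcol zh.2 i).
Let mem (st : saga_state R N d) i k :=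
  memory (mem_B st i k) (mem_D st i k).

(** The running aggregates are the sums of the tables, which puts the SAGA updates in the estimator
    form of [one_step]. *)
Definition saga_invariant (st : saga_state R N d) : Prop :=
  (forall i, submxcol (saga_ubar st) i = \sum_k saga_U st i k) /\
  (forall k, submxcol (saga_vbar st) k = \sum_i (saga_V st i k)^T).

(* Entry (i, k) of the tables is refreshed with probability p i * q k. *)
Definition saga_lyapunov (st : saga_state R N d) : R :=
  Gamma * Om (saga_z st) + 3 * \sum_i \sum_k mem st i k / (p i * q k).

Lemma saga_init_invariant w : saga_invariant (saga_init X w).
Proof.
split=> [i|k] /=; first by rewrite submxcol_mulmx.
rewrite submxcolZ submxcol_mulmxT scaler_sumr; apply: eq_bigr => i _.
by rewrite linearZ /= trmx_mul trmxK.
Qed.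

Lemma saga_step_invariant j l st : saga_invariant st ->
  saga_invariant (saga_update j l st).
Proof.
case: st => y ubar vbar U V [/= hu hv]; split=> [i|k] /=; rewrite mxcolK.
- have [->|ij] := eqVneq i j; last first.
    by rewrite hu; apply: eq_bigr => k _.
  rewrite hu (bigD1 l) //= [in RHS](bigD1 l) //= eqxx [U j l + _]addrC addrK addrC.
  congr (_ + _).
  by apply: eq_bigr => k kl; rewrite (negbTE kl).
- have [->|kl] := eqVneq k l; last first.
    by rewrite hv; apply: eq_bigr => i _; rewrite andbF.
  rewrite hv (bigD1 j) //= [in RHS](bigD1 j) //= eqxx [(V j l)^T + _]addrC addrK addrC.
  rewrite linearZ /= trmxK; congr (_ + _).
  by apply: eq_bigr => i ij; rewrite (negbTE ij).
Qed.

(** A step pays 2 times the unweighted memory and the refresh, with weight 3, recovers it 3 times.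
    The surplus is at least 1/Gamma times the weighted memory, exactly a decrease by 1/(3 Gamma) of
    its weight 3. The current gaps cost 5/18 of Omega, and 1 - 5/18 exceeds 1/3. *)
Lemma saga_step_mean st : saga_invariant st ->
  draw_mean p q (fun j l => saga_lyapunov (saga_update j l st))
    <= (1 - 1 / (3 * Gamma)) * saga_lyapunov st.
Proof.
move=> [hu hv]; set y := saga_z st.
have := @one_step y
  (fun l i => submxcol (saga_ubar st) i - (q l)^-1 *: saga_U st i l
          + (q l)^-1 *: (submxblock X i l *m submxcol y.1 l))
  (fun j k => submxcol (saga_vbar st) k - (p j)^-1 *: (saga_V st j k)^T
          + (p j * m%:R)^-1 *: ((submxblock X j k)^T *m submxcol y.2 j))
  (mem_B st) (mem_D st).
rewrite /= -/(Om y) -/(cur y).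
rewrite -[\sum_i \sum_k memory (mem_B st i k) _]/(\sum_i \sum_k mem st i k).
move=> H; have {}H := H _ _; have {}H : Gamma * draw_mean p q (fun j l =>
    Om (saga_z (saga_update j l st)))
    <= (Gamma - 1) * Om y + 2 * cur y + 2 * (\sum_i \sum_k mem st i k).
  rewrite (@eq_draw_mean _ _ _ p q _ (fun j l => Om (coord_update sigma tau h psi j l
    (fun i => submxcol (saga_ubar st) i - (q l)^-1 *: saga_U st i l
          + (q l)^-1 *: (submxblock X i l *m submxcol y.1 l))
    (fun k => submxcol (saga_vbar st) k - (p j)^-1 *: (saga_V st j k)^T
          + (p j * m%:R)^-1 *: ((submxblock X j k)^T *m submxcol y.2 j)) y))); last first.
    by move=> j l; rewrite /y; case: (st).
  apply: H => [l i|j k].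
  - rewrite /mem_B /primal_gap hu submxcol_mulmx [RHS]addrA.
    have -> : \sum_k submxblock X i k *m submxcol zh.1 k +
      \sum_k (saga_U st i k - submxblock X i k *m submxcol zh.1 k) = \sum_k saga_U st i k.
      by rewrite -big_split; apply: eq_bigr => k _ /=; rewrite addrC subrK.
    by rewrite mulmxBr opprB addrA subrK scalerBr addrA addrAC.
  - rewrite /mem_D /dual_gap hv submxcolZ submxcol_mulmxT scaler_sumr [RHS]addrA.
    have -> : \sum_i m%:R^-1 *: ((submxblock X i k)^T *m submxcol zh.2 i) +
      \sum_i ((saga_V st i k)^T - m%:R^-1 *: ((submxblock X i k)^T *m submxcol zh.2 i))
      = \sum_i (saga_V st i k)^T.
      by rewrite -big_split; apply: eq_bigr => i _ /=; rewrite addrC subrK.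
    rewrite mulmxBr (scalerBr m%:R^-1) opprB addrA subrK scalerBr invfM -scalerA.
    by rewrite addrA addrAC.
have memE i k : draw_mean p q (fun j l => mem (saga_update j l st) i k)
   = p i * q k * memory (primal_gap y i k) (dual_gap y i k)
     + (1 - p i * q k) * mem st i k.
  rewrite -(draw_mean_if_cell p_sum1 q_sum1); apply: eq_draw_mean => j l.
  rewrite /mem /mem_B /mem_D /y; case: (st) => y' ub vb U V /=.
  case: ifP => // _; rewrite /primal_gap /dual_gap !mulmxBr scalerBr.
  by rewrite linearZ /= trmxK.
have pq0 i k : 0 < p i * q k by rewrite mulr_gt0.
(* The weight cancels the refresh probability, so the fresh entries contribute exactly [cur y]. *)
have {}memE : draw_mean p q
     (fun j l => \sum_i \sum_k mem (saga_update j l st) i k / (p i * q k))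
   = cur y + \sum_i \sum_k mem st i k / (p i * q k) - \sum_i \sum_k mem st i k.
  rewrite draw_mean_sum /cur -big_split -sumrB /=; apply: eq_bigr => i _.
  rewrite draw_mean_sum -big_split -sumrB /=; apply: eq_bigr => k _.
  rewrite (@eq_draw_mean _ _ _ p q _
    (fun j l => (p i * q k)^-1 * mem (saga_update j l st) i k)).
    by rewrite draw_meanZ memE; field; rewrite !gt_eqF.
  by move=> j l; rewrite mulrC.
rewrite /saga_lyapunov draw_meanD !draw_meanZ memE -/y.
have hm : Gamma^-1 * (\sum_i \sum_k mem st i k / (p i * q k)) <= \sum_i \sum_k mem st i k.
  rewrite mulr_sumr; apply: ler_sum => i _; rewrite mulr_sumr; apply: ler_sum => k _.
  have [_ _ h3] := Gamma_ge i k.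
  rewrite mulrCA ler_piMr ?memory_ge0 //.
  by rewrite mulrC ler_pdivrMr // mul1r.
have hc := cur_bound y; have o0 := Om_ge0 y; have G1 := Gamma_gt1.
move: H hm hc o0; move: (draw_mean p q _) (\sum_i \sum_k mem st i k / _)
  (\sum_i \sum_k mem st i k) (cur y) (Om y) => E S1 S2 c o H hm hc o0.
have -> : (1 - 1 / (3 * Gamma)) * (Gamma * o + 3 * S1) =
   Gamma * o - o / 3 + 3 * S1 - Gamma^-1 * S1 by field; rewrite gt_eqF.
lra.
Qed.

Lemma eq_saga_iter xi xi' M y : (forall t, (t < M)%N -> xi t = xi' t) ->
  saga_run xi M y = saga_run xi' M y.
Proof.
elim: M => [//|M IH] e /=; rewrite e // IH // => t tM.
by apply: e; exact: ltnW.
Qed.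

Lemma saga_iter_mean M y :
  seq_mean p q M (fun s => saga_lyapunov (saga_run (nth draw0 s) M y))
    <= (1 - 1 / (3 * Gamma)) ^+ M * saga_lyapunov (saga_init X y).
Proof.
have inv xi k : saga_invariant (saga_run xi k y).
  elim: k => [|k IH]; first exact: saga_init_invariant.
  exact: saga_step_invariant.
have r0 : 0 <= 1 - 1 / (3 * Gamma).
  by rewrite subr_ge0 ler_pdivrMr ?mulr_gt0 // mul1r; have := Gamma_gt1; lra.
elim: M => [|M IH]; first by rewrite /= expr0 mul1r.
rewrite seq_mean_rcons exprS -mulrA.
apply: le_trans (ler_wpM2l r0 IH); rewrite -seq_meanZ.
apply: ler_seq_mean => // s sM; apply: le_trans (saga_step_mean (inv _ M)).
apply: eq_ler; apply: eq_draw_mean => j l /=; rewrite nth_rcons sM ltnn eqxx /=.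
congr (saga_lyapunov (saga_step _ _ _ _ _ _ _ _ _ _)).
by apply: eq_saga_iter => t tM; rewrite nth_rcons sM tM.
Qed.

(** Initially the tables hold the current products, so the Lyapunov function is at most (1 + 3/18)
    Gamma Omega. The choice of M contracts it by (3 / (8 (1 + delta)))^2, and 7/6 * 9/64 = 21/128 is
    below 1/4. *)
Lemma saga_contraction y :
  seq_mean p q (saga_M delta Gamma)
    (fun s => Om (dscovr_saga X p q sigma tau h psi (nth draw0 s) (saga_M delta Gamma) y))
    <= (1 / (2 * (1 + delta))) ^+ 2 * Om y.
Proof.
rewrite -(ler_pM2l Gamma_gt0) -seq_meanZ; set M := saga_M delta Gamma.
apply: le_trans (_ : seq_mean p q M
   (fun s => saga_lyapunov (saga_run (nth draw0 s) M y)) <= _).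
  apply: ler_seq_mean => // s _; rewrite lerDl mulr_ge0 // sumr_ge0 // => i _.
  by rewrite sumr_ge0 // => k _; rewrite divr_ge0 ?memory_ge0 // ltW // mulr_gt0.
apply: le_trans (saga_iter_mean _ _) _.
have L0 : saga_lyapunov (saga_init X y) <= 7 / 6 * (Gamma * Om y).
  have hS : \sum_i \sum_k mem (saga_init X y) i k / (p i * q k) <= Gamma * cur y.
    rewrite mulr_sumr; apply: ler_sum => i _; rewrite mulr_sumr; apply: ler_sum => k _.
    have [_ _ h3] := Gamma_ge i k.
    have -> : mem (saga_init X y) i k = memory
        (primal_gap y i k) (dual_gap y i k).
      rewrite /mem /mem_B /mem_D /= /primal_gap /dual_gap !mulmxBr scalerBr.
      by rewrite linearZ /= trmx_mul trmxK.
    by rewrite mulrC ler_wpM2r ?memory_ge0.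
  rewrite /saga_lyapunov /=; have := ler_wpM2l (ltW Gamma_gt0) (cur_bound y); lra.
have r0 : 0 <= 1 - 1 / (3 * Gamma).
  by rewrite subr_ge0 ler_pdivrMr ?mulr_gt0 // mul1r; have := Gamma_gt1; lra.
apply: le_trans (ler_wpM2l (exprn_ge0 M r0) L0) _.
have GO : 0 <= Gamma * Om y by rewrite mulr_ge0 // ltW.
have e0 : 0 < 8 * (1 + delta) / 3 :> R by rewrite divr_gt0 // mulr_gt0.
have hM : (1 - 1 / (3 * Gamma)) ^+ M <= (3 / (8 * (1 + delta))) ^+ 2.
  apply: le_trans (_ : expR (- (2 * ln (8 * (1 + delta) / 3))) <= _).
    apply: expn_le_expR => //.
    have := nceil_ge (6 * ln (8 * (1 + delta) / 3) * Gamma).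
    rewrite -/(saga_M _ _) -/M => h1.
    have h2 : 0 <= 1 / (3 * Gamma) by rewrite divr_ge0 // mulr_ge0 // ltW.
    apply: le_trans (ler_wpM2r h2 h1); apply: eq_ler.
    by field; rewrite gt_eqF.
  rewrite -mulrN expRM_natl expRN lnK ?posrE // invf_div.
  exact: lexx.
rewrite mulrA [leRHS]mulrCA [leRHS]mulrC [leRHS]mulrC ler_wpM2r //.
have c76 : 0 <= 7 / 6 :> R by rewrite divr_ge0.
apply: le_trans (ler_wpM2r c76 hM) _.
have -> : (3 / (8 * (1 + delta))) ^+ 2 * (7 / 6) = 21 / 32 * (1 / (2 * (1 + delta))) ^+ 2.
  by field; rewrite gt_eqF.
have := sqr_ge0 (1 / (2 * (1 + delta))); move: (_ ^+ 2) => b; lra.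
Qed.

End InnerSolvers.

(** * Outer rounds *)

Variable opt : dscovr_option.

Local Notation acc :=
  (acc_dscovr opt X f g lambda gamma p q delta Gamma sigma tau).

Let Om (z : primal * dual) := Omega lambda gamma (z.1 - wstar) (z.2 - alphastar).

Definition round_length : nat :=
  match opt with
  | OptionSVRG => svrg_S delta * svrg_M Gamma
  | OptionSAGA => saga_M delta Gamma
  end.

(** As a run of length 1, it makes the last round of any run convertible to it, for both options at
    once. *)
Definition dscovr_round (z : primal * dual) (xi : nat -> 'I_m * 'I_n) : primal * dual :=
  acc z (fun _ => xi) 1.

Let d0 : 0 < 1 + delta. Proof. exact: addr_gt0. Qed.

Lemma eq_dscovr_round z xi xi' : (forall t, (t < round_length)%N -> xi t = xi' t) ->
  dscovr_round z xi = dscovr_round z xi'.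
Proof.
rewrite /dscovr_round /round_length /=; case: opt => e.
  exact: eq_dscovr_svrg.
by rewrite /dscovr_saga; congr saga_z; exact: eq_saga_iter.
Qed.

Lemma svrg_S_contraction : (2 / 3) ^+ svrg_S delta <= (1 / (2 * (1 + delta))) ^+ 2.
Proof.
have l32 : 0 < ln (3 / 2 : R) by rewrite ln_gt0 // ltr_pdivlMr // mul1r ltr_nat.
have e0 : 0 < 2 * (1 + delta) by rewrite mulr_gt0.
have -> : 2 / 3 = expR (- ln (3 / 2 : R)).
  by rewrite expRN lnK ?posrE ?divr_gt0 // invf_div.
have -> : 1 / (2 * (1 + delta)) = expR (- ln (2 * (1 + delta))).
  by rewrite expRN lnK ?posrE // div1r.
rewrite -!expRM_natl ler_expR !mulrN lerN2 -ler_pdivrMr //.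
exact: nceil_ge.
Qed.

Lemma inner_contraction z zh :
  perturbed_saddle X f g lambda gamma delta z zh ->
  seq_mean p q round_length (fun s => Omega lambda gamma
      ((dscovr_round z (nth draw0 s)).1 - zh.1) ((dscovr_round z (nth draw0 s)).2 - zh.2))
    <= (1 / (2 * (1 + delta))) ^+ 2 * Omega lambda gamma (z.1 - zh.1) (z.2 - zh.2).
Proof.
move=> zhP; rewrite /round_length /dscovr_round; case: opt => /=.
  apply: le_trans.
    by apply: dscovr_svrg_mean => zbar; exact: svrg_stage_contraction.
  by rewrite ler_wpM2r ?Omega_ge0 // svrg_S_contraction.
exact: saga_contraction.
Qed.

Lemma round_mean z :
  seq_mean p q round_length (fun s => Om (dscovr_round z (nth draw0 s)))
    <= (1 - 1 / (2 * (1 + delta))) ^+ 2 * Om z.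
Proof.
have [zh zhP] := perturbed_saddle_exists m_gt0 lambda_gt0 gamma_gt0 f_convex g_convex
  star z delta_gt0.
have [h1 h2] := perturbed_saddle_contraction m_gt0 lambda_gt0 gamma_gt0 f_smooth g_convex
  star delta_gt0 zhP.
have h3 := inner_contraction zhP.
(* 2 * delta is the ratio of the two rates: with it Young's inequality is as
   sharp as Minkowski's. *)
have c2 : 0 < 2 * delta by rewrite mulr_gt0.
pose Oh s := Omega lambda gamma
      ((dscovr_round z (nth draw0 s)).1 - zh.1) ((dscovr_round z (nth draw0 s)).2 - zh.2).
pose Os := Omega lambda gamma (zh.1 - wstar) (zh.2 - alphastar).
apply: (@le_trans _ _ (seq_mean p q round_length
    (fun s => (1 + 2 * delta) * Oh s + (1 + (2 * delta)^-1) * Os))).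
  apply: ler_seq_mean => // s _; rewrite /Om /Oh /Os.
  rewrite -[_.1 - wstar](subrKA zh.1) -[_.2 - alphastar](subrKA zh.2).
  exact: Omega_youngD.
rewrite seq_meanD seq_meanZ seq_mean_cst //.
move: h1 h2 h3; rewrite -[in X in _ -> X](opprB zh.1) -(opprB zh.2) OmegaN.
rewrite -/(Om z) -/Os; move: (seq_mean _ _ _ _) (Omega _ _ _ _) (Om z) (Os) => E Q S0 O' h1 h2 h3.
have e1 : 0 <= 1 + 2 * delta by rewrite addr_ge0 // ltW.
have e2 : 0 <= 1 + (2 * delta)^-1 by rewrite addr_ge0 // invr_ge0 ltW.
have {}h3 := ler_wpM2l e1 (le_trans h3 (ler_wpM2l (sqr_ge0 _) h2)).
apply: le_trans (lerD h3 (ler_wpM2l e2 h1)) _.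
by apply: eq_ler; field; rewrite !gt_eqF.
Qed.

Lemma eq_acc_dscovr xi xi' r z :
  (forall a t, (a < r)%N -> (t < round_length)%N -> xi a t = xi' a t) ->
  acc z xi r
    = acc z xi' r.
Proof.
elim: r => [//|r IH] e.
rewrite -[LHS]/(dscovr_round (acc z xi r) (xi r)).
rewrite -[RHS]/(dscovr_round (acc z xi' r) (xi' r)).
rewrite IH => [|a t ar tL]; last by apply: e => //; exact: ltnW.
by apply: eq_dscovr_round => t tL; exact: e.
Qed.

Lemma acc_dscovr_mean r z :
  seq_mean p q (r * round_length) (fun s => Om
    (acc z
      (fun a t => nth draw0 s (a * round_length + t)) r))
    <= (1 - 1 / (2 * (1 + delta))) ^+ (2 * r) * Om z.
Proof.
elim: r => [|r IH]; first by rewrite muln0 mul0n /= expr0 mul1r.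
(* Round [a] owns the positions from [a * round_length] on; the last round is averaged with the
   result of the earlier ones as its fixed centre. *)
rewrite mulSn addnC seq_mean_cat mulnS exprD -mulrA.
apply: le_trans (ler_wpM2l (sqr_ge0 _) IH); rewrite -seq_meanZ.
apply: ler_seq_mean => // s sr; apply: le_trans (round_mean _).
apply: eq_ler; apply: eq_seq_mean => s' s'L; congr Om.
rewrite -[LHS]/(dscovr_round (acc z
  (fun a t => nth draw0 (s ++ s') (a * round_length + t)) r)
  (fun t => nth draw0 (s ++ s') (r * round_length + t))).
rewrite (@eq_acc_dscovr _ (fun a t => nth draw0 s (a * round_length + t))) => [|a t ar tL].
  by apply: eq_dscovr_round => t tL; rewrite nth_cat sr ltnNge leq_addr /= addKn.
rewrite nth_cat sr ifT //; apply: leq_trans (_ : (a.+1 * round_length <= _)%N).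
  by rewrite mulSn addnC ltn_add2r.
by rewrite leq_mul2r ar orbT.
Qed.

End Dscovr.

(** * Expectations as finite means *)

Lemma sum_tuple_cons {R : nmodType} (C : finType) k (F : k.+1.-tuple C -> R) :
  \sum_x F x = \sum_c \sum_(y : k.-tuple C) F [tuple of c :: y].
Proof.
rewrite pair_big (reindex (fun y : C * k.-tuple C => [tuple of y.1 :: y.2])) //=.
exists (fun x => (thead x, [tuple of behead x])) => [[c y] _|x _] /=.
  by congr pair; apply: val_inj.
by rewrite -tuple_eta.
Qed.

Lemma seq_mean_tuple {R : realType} m n (p : 'I_m -> R) (q : 'I_n -> R) k G :
  seq_mean p q k G
    = \sum_(x : k.-tuple ('I_m * 'I_n)) (\prod_(c <- x) (p c.1 * q c.2)) * G x.
Proof.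
elim: k G => [|k IH] G.
  rewrite (bigD1 [tuple]) //= big_nil mul1r big1 ?addr0 // => x.
  by rewrite tuple0 => /eqP.
rewrite sum_tuple_cons /= /draw_mean pair_big /=; apply: eq_bigr => -[j l] _ /=.
rewrite IH mulr_sumr; apply: eq_bigr => y _.
by rewrite big_cons mulrA.
Qed.

Section Expectation.
Context {disp : measure_display} {T : measurableType disp} {R : realType}.
Variables (P : probability T R) (m n : nat) (p : 'I_m -> R) (q : 'I_n -> R)
  (J : nat -> nat -> T -> 'I_m) (K : nat -> nat -> T -> 'I_n).
Hypothesis draws : independent_draws P p q J K.

Let draw om (a : nat * nat) := (J a.1 a.2 om, K a.1 a.2 om).

Let cylinder (s : seq (nat * nat)) (x : seq ('I_m * 'I_n)) : set T :=
  [set om | map (draw om) s = x].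

(** A cylinder is split into separate events for J and K, indexed by the sum type of
    [mutually_independent]; [index] recovers the position of a draw in [s]. *)
Let event (s : seq (nat * nat)) (x : seq ('I_m * 'I_n)) c0
    (b : (nat * nat) + (nat * nat)) : set T :=
  match b with
  | inl a => J a.1 a.2 @^-1` [set (nth c0 x (index a s)).1]
  | inr a => K a.1 a.2 @^-1` [set (nth c0 x (index a s)).2]
  end.

Let cylinderE s x c0 : uniq s -> size x = size s ->
  cylinder s x = \bigcap_(b in [set` map inl s ++ map inr s]) event s x c0 b.
Proof.
move=> us sx; apply/seteqP; split=> om /=.
  move=> <- b; rewrite /= mem_cat => /orP[] /mapP[a as_ ->] /=.
    by rewrite (nth_map (0, 0)%N) ?index_mem //= nth_index.
  by rewrite (nth_map (0, 0)%N) ?index_mem //= nth_index.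
move=> h; apply: (@eq_from_nth _ c0); rewrite size_map // => i i_s.
rewrite (nth_map (0, 0)%N) //; set a := nth _ s i.
have as_ : a \in s by rewrite mem_nth.
have hJ : J a.1 a.2 om = (nth c0 x (index a s)).1.
  by apply: (h (inl a)); rewrite /= mem_cat map_f.
have hK : K a.1 a.2 om = (nth c0 x (index a s)).2.
  by apply: (h (inr a)); rewrite /= mem_cat [X in _ || X]map_f ?orbT.
rewrite /draw hJ hK index_uniq //; by case: (nth _ _ _).
Qed.

Let sigma_event s x c0 b :
  match b with
  | inl rt => sigma_discrete (J rt.1 rt.2)
  | inr rt => sigma_discrete (K rt.1 rt.2)
  end (event s x c0 b).
Proof.
by case: b => a /=; [exists [set (nth c0 x (index a s)).1]
  |exists [set (nth c0 x (index a s)).2]].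
Qed.

Let measurable_cylinder s x : uniq s -> size x = size s ->
  measurable (cylinder s x).
Proof.
(* An empty [x] offers no default for [nth]; then [s] is empty too and the cylinder is the whole
   space. *)
case: x => [|c0 x] us sx.
  have -> : cylinder s [::] = setT.
    by apply/seteqP; split=> // om _; rewrite /cylinder /= (size0nil (esym sx)).
  exact: measurableT.
rewrite (cylinderE c0) //; apply: fin_bigcap_measurable => [|b _].
  exact: finite_seq.
have [mJK _ _ _] := draws; have := sigma_event s (c0 :: x) c0 b.
by case: b => a /=; [apply: (mJK _ _).1|apply: (mJK _ _).2].
Qed.

Let cylinder_prob s x : uniq s -> size x = size s ->
  P (cylinder s x) = (\prod_(c <- x) (p c.1 * q c.2))%:E.
Proof.
case: x => [|c0 x] us sx.
  have -> : cylinder s [::] = setT.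
    by apply/seteqP; split=> // om _; rewrite /cylinder /= (size0nil (esym sx)).
  by rewrite big_nil probability_setT.
move: (c0 :: x) sx => {}x sx.
have [_ PJ PK indep] := draws.
rewrite (cylinderE c0) // indep => [||b _]; last exact: sigma_event.
  rewrite big_cat !big_map /=.
  under eq_bigr do rewrite PJ; under [X in (_ * X)%E]eq_bigr do rewrite PK.
  rewrite !prodEFin -EFinM -big_split /= (big_nth (0, 0)%N) [in RHS](big_nth c0) sx.
  congr (_%:E); rewrite !big_nat; apply: eq_bigr => i /andP[_ i_s].
  by rewrite index_uniq.
rewrite cat_uniq !map_inj_uniq ?us ?andbT //; last 2 first.
- by move=> a b [].
- by move=> a b [].
by apply/hasPn => _ /mapP[a _ ->]; apply/negP => /mapP[].
Qed.

(** The integrand is a finite combination of indicators of cylinders, so measurability comes from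
    the draws rather than from the proximal maps, and nonnegativity allows integration term by
    term. *)
Lemma expectation_seq_mean s (G : seq ('I_m * 'I_n) -> R) : uniq s ->
  (forall x, 0 <= G x) ->
  ('E_P[fun om => G [seq (J a.1 a.2 om, K a.1 a.2 om) | a <- s]]
    = (seq_mean p q (size s) G)%:E)%E.
Proof.
move=> us G0; rewrite unlock seq_mean_tuple.
have -> : (fun om => (G [seq (J a.1 a.2 om, K a.1 a.2 om) | a <- s])%:E) =
   (fun om => \sum_(x : (size s).-tuple ('I_m * 'I_n))
      ((G x)%:E * (\1_(cylinder s x) om)%:E)%E).
  apply/funext => om.
  have sz : size (map (draw om) s) == size s by rewrite size_map.
  rewrite (bigD1 (Tuple sz)) //= big1 => [|x xn].
    by rewrite addr0 indicE mem_set ?mule1.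
  rewrite indicE memNset ?mule0 //= => h.
  by move/eqP: xn; apply; apply: val_inj.
have mc (x : (size s).-tuple ('I_m * 'I_n)) : measurable (cylinder s x).
  by apply: measurable_cylinder; rewrite ?size_tuple.
rewrite ge0_integral_sum //=; last 2 first.
- move=> x; apply: measurable_funeM; apply/measurable_realfun.measurable_EFinP.
  exact: measurable_realfun.measurable_indic.
- by move=> x om _; rewrite mule_ge0 // lee_fin.
rewrite -sumEFin; apply: eq_bigr => x _.
rewrite ge0_integralZl_EFin //.
  rewrite integral_indic // setIT -[LHS]/((G x)%:E * P (cylinder s x))%E.
  by rewrite cylinder_prob ?size_tuple // -EFinM mulrC.
by apply/measurable_realfun.measurable_EFinP; exact: measurable_realfun.measurable_indic.
Qed.

End Expectation.

Theorem theorem4 (R : realType) (m n : nat) (N : 'I_m -> nat) (d : 'I_n -> nat)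
  (m_gt0 : (0 < m)%N) (n_gt0 : (0 < n)%N)
  (N_gt0 : forall i, (0 < N i)%N) (d_gt0 : forall k, (0 < d k)%N)
  (X : 'M[R]_(\sum_i N i, \sum_k d k))
  (f : forall i, 'cV[R]_(N i) -> R) (g : forall k, 'cV[R]_(d k) -> R)
  (lambda : R) (gamma : 'I_m -> R)
  (lambda_gt0 : 0 < lambda) (gamma_gt0 : forall i, 0 < gamma i)
  (f_convex : forall i, convex_function [set: 'cV[R]_(N i)] (f i))
  (f_smooth : forall i, lipschitz_gradient (1 / gamma i) (f i))
  (g_convex : strongly_convex lambda (separable_sum g))
  (wstar : 'cV[R]_(\sum_k d k)) (alphastar : 'cV[R]_(\sum_i N i))
  (saddle : saddle_point (Lagrangian X f g) wstar alphastar)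
  (p : 'I_m -> R) (q : 'I_n -> R)
  (p_gt0 : forall i, 0 < p i) (p_sum1 : \sum_i p i = 1)
  (q_gt0 : forall k, 0 < q k) (q_sum1 : \sum_k q k = 1)
  (delta : R) (delta_gt0 : 0 < delta)
  (Gamma : R)
  (Gamma_ge : forall i k,
     [/\ (p i)^-1 * (1 + 9 * specnorm (submxblock X i k) ^+ 2
            / (2 * q k * lambda * gamma i * (1 + delta) ^+ 2)) <= Gamma,
         (q k)^-1 * (1 + 9 * n%:R * specnorm (submxblock X i k) ^+ 2
            / (2 * p i * m%:R * lambda * gamma i * (1 + delta) ^+ 2)) <= Gamma
       & (p i * q k)^-1 <= Gamma])
  (pGamma_gt1 : forall i, 1 < p i * Gamma)
  (qGamma_gt1 : forall k, 1 < q k * Gamma)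
  (sigma : 'I_m -> R) (tau : 'I_n -> R)
  (sigmaE : forall i,
     sigma i = 1 / (2 * (1 + delta) * gamma i * (p i * Gamma - 1)))
  (tauE : forall k,
     tau k = 1 / (2 * (1 + delta) * lambda * (q k * Gamma - 1)))
  (disp : measure_display) (T : measurableType disp) (P : probability T R)
  (J : nat -> nat -> T -> 'I_m) (K : nat -> nat -> T -> 'I_n)
  (draws : independent_draws P p q J K)
  (opt : dscovr_option)
  (w0 : 'cV[R]_(\sum_k d k)) (alpha0 : 'cV[R]_(\sum_i N i))
  (r : nat) (r_ge1 : (1 <= r)%N) :
  ('E_P[fun om =>
     let z := acc_dscovr opt X f g lambda gamma p q delta Gamma sigma tau
                (w0, alpha0) (fun s t => (J s t om, K s t om)) r in
     Omega lambda gamma (z.1 - wstar)%R (z.2 - alphastar)%R]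
   <= ((1 - 1 / (2 * (1 + delta))) ^+ (2 * r)
       * Omega lambda gamma (w0 - wstar) (alpha0 - alphastar))%:E)%E.
Proof.
have star := saddle_pointP lambda m_gt0 gamma_gt0 f_convex f_smooth saddle.
pose c0 := (Ordinal m_gt0, Ordinal n_gt0).
pose L := round_length delta Gamma opt.
pose acc xi := acc_dscovr opt X f g lambda gamma p q delta Gamma sigma tau
  (w0, alpha0) xi r.
pose G s := Omega lambda gamma ((acc (fun a t => nth c0 s (a * L + t)%N)).1 - wstar)
  ((acc (fun a t => nth c0 s (a * L + t)%N)).2 - alphastar).
(* Euclidean division lists the draws round by round: position a L + t is iteration t of round a. *)
pose idx := mkseq (fun i => (i %/ L, i %% L)%N) (r * L).
have idx_uniq : uniq idx.
  by apply: mkseq_uniq => a b [ab1 ab2]; rewrite (divn_eq a L) ab1 ab2 -divn_eq.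
rewrite [X in ('E_P[X] <= _)%E](_ : _ =
    fun om => G [seq (J a.1 a.2 om, K a.1 a.2 om) | a <- idx]); last first.
  apply/funext => om /=; rewrite /G /acc.
  rewrite -(@eq_acc_dscovr _ _ _ _ _ X f g lambda gamma p q delta Gamma sigma tau opt
    (fun a t => (J a t om, K a t om))) // => a t ar tL.
  have L0 : (0 < L)%N by exact: leq_ltn_trans tL.
  have atL : (a * L + t < r * L)%N.
    apply: leq_trans (_ : (a.+1 * L <= _)%N); last by rewrite leq_mul2r ar orbT.
    by rewrite mulSn addnC ltn_add2r.
  rewrite (nth_map (0, 0)%N) ?size_mkseq // nth_mkseq //=.
  by rewrite divnMDl // divn_small // addn0 modnMDl modn_small.
rewrite (expectation_seq_mean draws) // => [|s]; last exact: Omega_ge0.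
rewrite size_mkseq lee_fin.
have := @acc_dscovr_mean R m n N d X f g lambda gamma m_gt0 n_gt0 lambda_gt0 gamma_gt0
  f_convex f_smooth g_convex wstar alphastar star p q delta Gamma p_gt0 p_sum1 q_gt0 q_sum1
  delta_gt0 Gamma_ge pGamma_gt1 qGamma_gt1 sigma tau sigmaE tauE c0 opt r (w0, alpha0).
exact.
Qed.
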